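(* Let $d\ge 1$. Let $\mathcal{A}$ be the abelian group of signed measures on $\mathbb{R}^d$ of the form $\sum_{i=1}^n \alpha_i [P_i]$ with each $P_i$ a non-codegenerate polytope and $\alpha_i\in\mathbb{Z}$, and let $\mathcal{D}\subset\mathcal{A}$ be the set of all measures $\pm[\Delta]$ with $\Delta$ a non-codegenerate simplex. Then the involution $\Phi:\mathcal{D}\to\mathcal{D}$ defined by $$\Phi(\pm[\Delta]) = \pm(-1)^{\sigma(\Delta)}[\Delta^\circ]$$ extends uniquely to an automorphism (of abelian groups) $\Phi:\mathcal{A}\to\mathcal{A}$.
   Context: A polytope (or polytopal region) $P\subset\mathbb{R}^d$, convex or not, is a finite union of full-dimensional compact convex polytopes. $[P]$ denotes the restriction of Lebesgue measure on $\mathbb{R}^d$ to $P$. A polytope is codegenerate if one of its facets is coplanar with the origin, i.e. the affine hyperplane containing that facet passes through the origin; otherwise it is non-codegenerate. A simplex means a full-dimensional ($d$-dimensional) simplex in $\mathbb{R}^d$. For a non-zero vector $v\in\mathbb{R}^d$ let $H_v=\{w\in\mathbb{R}^d : \langle w,v\rangle=1\}$, with $\langle\cdot,\cdot\rangle$ the standard inner product. If $\Delta$ is a non-codegenerate simplex with vertices $v_0,\dots,v_d$, its polar simplex $\Delta^\circ$ is the (compact) simplex bounded by the hyperplanes $H_{v_0},\dots,H_{v_d}$; equivalently, its vertices are the points $w_0,\dots,w_d$ with $\langle w_i,v_j\rangle=1$ for all $j\ne i$. It is again non-codegenerate. $\sigma(\Delta)$ is the number of supporting hyperplanes of $\Delta$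 (the affine hyperplanes spanned by its $d+1$ facets) that separate $\Delta$ from the origin. *)

(* Defs.v *)
From HB Require Import structures.
From mathcomp Require Import all_boot all_order all_algebra.
From mathcomp Require Import all_classical all_reals all_analysis.

Set Implicit Arguments.
Unset Strict Implicit.
Unset Printing Implicit Defensive.

Import Order.TTheory GRing.Theory Num.Theory.
Import numFieldNormedType.Exports.

Local Open Scope classical_set_scope.
Local Open Scope ring_scope.

(* R^n is the space 'rV[R]_n of row vectors, with the product (= Borel)
   sigma-algebra generated by the coordinates; its Lebesgue measure is the
   n-fold product of the Lebesgue measure of the line, through the
   identification R * R^n = R^n.+1. *)
Section borel.
Context {R : realType} (n : nat).

Let coors (i : 'I_n) (x : 'rV[R]_n) : measurableTypeR R := x ord0 i.

Let rV_set0 : g_sigma_preimage coors set0.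
Proof. exact: sigma_algebra0. Qed.

Let rV_setC A : g_sigma_preimage coors A -> g_sigma_preimage coors (~` A).
Proof. exact: sigma_algebraC. Qed.

Let rV_bigcup (F : (set 'rV[R]_n)^nat) :
  (forall i, g_sigma_preimage coors (F i)) ->
  g_sigma_preimage coors (\bigcup_i F i).
Proof. exact: sigma_algebra_bigcup. Qed.

HB.instance Definition _ := @isMeasurable.Build default_measure_display
  'rV[R]_n (g_sigma_preimage coors) rV_set0 rV_setC rV_bigcup.

Lemma measurable_coord (i : 'I_n) :
  measurable_fun [set: 'rV[R]_n] (fun x => x ord0 i : measurableTypeR R).
Proof.
move=> _ Y mY; rewrite setTI; apply: sub_sigma_algebra => /=.
rewrite -bigcup_seq/=; exists i => /=; first by rewrite mem_index_enum.
by exists Y => //; rewrite setTI.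
Qed.

Lemma measurable_fun_rV d (T : measurableType d) (f : T -> 'rV[R]_n) :
  (forall i, measurable_fun [set: T] (fun t => f t ord0 i : measurableTypeR R)) ->
  measurable_fun [set: T] f.
Proof.
move=> mf.
have prefS : g_sigma_preimage (fun i => coors i \o f) `<=` measurable.
  apply: smallest_sub; first exact: sigma_algebra_measurable.
  elim/big_ind: _ => [//|A B sA sB|i _]; first by rewrite subUset.
  by move=> _ [B mB <-]; exact: mf.
move=> _ A mA; apply: prefS; rewrite g_sigma_preimage_comp.
by exists A.
Qed.

End borel.

Definition rV_cons (R : realType) n (p : measurableTypeR R * 'rV[R]_n) :
  'rV[R]_n.+1 := row_mx (const_mx p.1 : 'rV_1) p.2.

Lemma measurable_rV_cons (R : realType) n :
  measurable_fun [set: measurableTypeR R * 'rV[R]_n] (@rV_cons R n).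
Proof.
apply: measurable_fun_rV => i.
case: (splitP (i : 'I_(1 + n))) => j ij.
  rewrite [X in measurable_fun _ X](_ : _ = fst) //; apply/funext => t.
  have -> : i = lshift n j by apply: val_inj.
  by rewrite (row_mxEl (const_mx t.1 : 'rV_1) t.2) mxE.
rewrite [X in measurable_fun _ X](_ : _ =
    fun t : measurableTypeR R * 'rV[R]_n => t.2 ord0 j); last first.
  apply/funext => t; have -> : i = rshift 1 j by apply: val_inj.
  by rewrite (row_mxEr (const_mx t.1 : 'rV_1) t.2).
exact: (measurableT_comp (measurable_coord j) measurable_snd).
Qed.

Lemma measurable_tail (R : realType) n : measurable_fun [set: 'rV[R]_n.+1]
  (fun x : 'rV[R]_n.+1 => \row_(j < n) x ord0 (lift ord0 j)).
Proof.
apply: measurable_fun_rV => j; under eq_fun do rewrite mxE.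
exact: measurable_coord.
Qed.

Section lebesgue_step.
Context (R : realType) (n : nat)
  (mu : {sigma_finite_measure set 'rV[R]_n -> \bar R}).
Local Open Scope ereal_scope.

Definition lebesgue_step : set 'rV[R]_n.+1 -> \bar R :=
  pushforward (@lebesgue_measure R \x mu) (@rV_cons R n).

HB.instance Definition _ := Measure.copy lebesgue_step
  (measure_function_pushforward__canonical__measure_function_Measure
    (@lebesgue_measure R \x mu)%E (@measurable_rV_cons R n)).

Let lebesgue_step_sigma_finite : sigma_finite setT lebesgue_step.
Proof.
have /sigma_finiteP[F [TF ndF Foo]] := sigma_finiteT (@lebesgue_measure R).
have /sigma_finiteP[G [TG ndG Goo]] := sigma_finiteT mu.
pose g (x : 'rV[R]_n.+1) : measurableTypeR R * 'rV[R]_n :=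
  (x ord0 ord0, (\row_(j < n) x ord0 (lift ord0 j))%R).
have gK : cancel (@rV_cons R n) g.
  move=> [x y]; rewrite /g /rV_cons/=; congr pair.
    rewrite (_ : ord0 = lshift n (ord0 : 'I_1)); last exact: val_inj.
    by rewrite (row_mxEl (const_mx x : 'rV_1) y) mxE.
  apply/rowP => j; rewrite mxE.
  rewrite (_ : lift ord0 j = rshift 1 j); last exact: val_inj.
  by rewrite (row_mxEr (const_mx x : 'rV_1) y).
have mg : measurable_fun setT g.
  by apply: measurable_fun_pair; [exact: measurable_coord|exact: measurable_tail].
exists (fun i => g @^-1` (F i `*` G i)).
  rewrite -preimage_bigcup -[LHS](preimage_setT g); congr preimage.
  rewrite -setXTT TF TG predeqE => -[x y]; split.
    move=> [/= [i _ Fx] [k _ Gy]]; exists (maxn i k) => //; split.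
    - by move: x Fx; exact/subsetPset/ndF/leq_maxl.
    - by move: y Gy; exact/subsetPset/ndG/leq_maxr.
  by move=> [i _ []/= ? ?]; split; exists i.
move=> i; have [mF Fioo] := Foo i; have [mG Gioo] := Goo i; split.
  by rewrite -[X in measurable X]setTI; apply: mg => //; exact: measurableX.
rewrite /lebesgue_step /pushforward -comp_preimage.
rewrite (_ : g \o _ = id); last exact/funext.
by rewrite preimage_id product_measure1E// lte_mul_pinfty// ge0_fin_numE.
Qed.

HB.instance Definition _ := Measure_isSigmaFinite.Build _ _ _ lebesgue_step
  lebesgue_step_sigma_finite.

End lebesgue_step.

Fixpoint lebesgue_rV (R : realType) (n : nat) :
    {sigma_finite_measure set 'rV[R]_n -> \bar R} :=
  if n is m.+1 then lebesgue_step (lebesgue_rV R m) else \d_ (0 : 'rV[R]_0).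

Lemma lebesgue_rV_box (R : realType) n (A : 'I_n -> set (measurableTypeR R)) :
  (forall i, measurable (A i)) ->
  (lebesgue_rV R n [set x | forall i, A i (x ord0 i)] =
   \prod_(i < n) lebesgue_measure (A i))%E.
Proof.
elim: n A => [|n IH] A mA.
  rewrite big_ord0 /= diracE mem_set //= => -[]//.
rewrite big_ord_recl /= /lebesgue_step /pushforward.
rewrite -(IH (A \o lift ord0)); last by move=> i; exact: mA.
have c0 p : @rV_cons R n p ord0 ord0 = p.1.
  rewrite /rV_cons (_ : ord0 = lshift n (ord0 : 'I_1)); last exact: val_inj.
  by rewrite (row_mxEl (const_mx p.1 : 'rV_1) p.2) mxE.
have cS p j : @rV_cons R n p ord0 (lift ord0 j) = p.2 ord0 j.
  rewrite /rV_cons (_ : lift ord0 j = rshift 1 j); last exact: val_inj.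
  by rewrite (row_mxEr (const_mx p.1 : 'rV_1) p.2).
rewrite -product_measure1E//=.
- congr (product_measure1 _ _ _); apply/seteqP; split=> p /= Ap.
    by split=> [|j]; [rewrite -c0|rewrite -cS]; exact: Ap.
  by case: Ap => A0 AS i; case: (unliftP ord0 i) => [j|] ->;
    rewrite ?cS ?c0//; exact: AS.
- rewrite [X in measurable X](_ : _ = \bigcap_(i in [set: 'I_n])
    ((fun x : 'rV[R]_n => x ord0 i : measurableTypeR R) @^-1`
      (A (lift ord0 i)))).
    apply: fin_bigcap_measurable => [|i _]; first exact: finite_finset.
    by rewrite -[X in measurable X]setTI; exact: measurable_coord.
  by apply/seteqP; split=> x /= Ax i; [move=> _|]; exact: Ax.
Qed.

Section polytopes.
Context {R : realType} {d : nat}.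
Implicit Types (u v x : 'rV[R]_d) (P : set 'rV[R]_d).

Definition dot u v : R := \sum_(i < d) u ord0 i * v ord0 i.

Definition hull n (p : 'I_n -> 'rV[R]_d) : set 'rV[R]_d :=
  [set x | exists a : 'I_n -> R,
     [/\ forall i, 0 <= a i, \sum_i a i = 1 & x = \sum_i a i *: p i]].

Definition affinely_independent n (p : 'I_n -> 'rV[R]_d) : Prop :=
  forall a : 'I_n -> R,
    \sum_i a i = 0 -> \sum_i a i *: p i = 0 -> forall i, a i = 0.

Definition full_dimensional P : Prop :=
  exists p : 'I_d.+1 -> 'rV[R]_d,
    affinely_independent p /\ forall i, P (p i).

Definition convex_polytope P : Prop :=
  (exists n (p : 'I_n -> 'rV[R]_d), P = hull p) /\ full_dimensional P.

Definition polytope P : Prop :=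
  exists n (Q : 'I_n -> set 'rV[R]_d),
    (forall i, convex_polytope (Q i)) /\ P = \bigcup_i Q i.

Definition frontier P : set 'rV[R]_d := closure P `\` P°.

Definition hyperplane u (c : R) : set 'rV[R]_d := [set x | dot x u = c].

(* A polytope need not be convex, so a facet is a (d-1)-dimensional piece of
   the frontier: the hyperplane is spanned by a facet of P when the part of
   the frontier of P lying in it has nonempty relative interior. *)
Definition facet_hyperplane P u (c : R) : Prop :=
  u != 0 /\ exists2 x, hyperplane u c x &
    \forall y \near x, hyperplane u c y -> frontier P y.

Definition codegenerate P : Prop := exists u, facet_hyperplane P u 0.

(* The simplex with vertices v 0, ..., v d is hull v. *)
Definition noncodegenerate_simplex (v : 'I_d.+1 -> 'rV[R]_d) : Prop :=
  affinely_independent v /\ ~ codegenerate (hull v).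

Definition polar_vertices (v w : 'I_d.+1 -> 'rV[R]_d) : Prop :=
  forall i j, j != i -> dot (w i) (v j) = 1.

(* The hyperplane spanned by the facet opposite to v i separates hull v from
   the origin; it is oriented so that hull v is on the side c <= dot x u. *)
Definition separating_facet (v : 'I_d.+1 -> 'rV[R]_d) (i : 'I_d.+1) : Prop :=
  exists u c,
    [/\ u != 0, forall j, j != i -> hyperplane u c (v j),
        forall x, hull v x -> c <= dot x u & dot 0 u < c].

Definition sigma (v : 'I_d.+1 -> 'rV[R]_d) : nat :=
  #|[pred i | `[< separating_facet v i >]]|.

End polytopes.

(* The restriction of Lebesgue measure to a polytope is finite, so all signed
   measures considered below are determined by their real values on the Borel
   sets; they live in the group, for pointwise addition, of real functions on
   the Borel sigma-algebra. *)
Definition borel_set (R : realType) d : Type :=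
  set_type (@measurable _ 'rV[R]_d).

Definition lebesgue_on (R : realType) d (P : set 'rV[R]_d) :
  borel_set R d -> R := fun B => fine (lebesgue_rV R d (P `&` \val B)).

Definition polytope_measure_pred (R : realType) d : {pred borel_set R d -> R} :=
  [pred nu | `[< exists n (P : 'I_n -> set 'rV[R]_d) (alpha : 'I_n -> int),
      (forall i, polytope (P i) /\ ~ codegenerate (P i)) /\
      nu = \sum_i lebesgue_on (P i) *~ alpha i >]].

Fact polytope_measure_zmod_closed (R : realType) d :
  zmod_closed (@polytope_measure_pred R d).
Proof.
split=> [|nu1 nu2 /asboolP[n1 [P1 [a1 [h1 ->]]]] /asboolP[n2 [P2 [a2 [h2 ->]]]]].
  apply/asboolP; exists 0, (fun=> set0), (fun=> 0); split=> [[]//|].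
  by rewrite big_ord0.
apply/asboolP; exists (n1 + n2)%N.
exists (fun i : 'I_(n1 + n2) => match fintype.split i with inl j => P1 j | inr j => P2 j end).
exists (fun i : 'I_(n1 + n2) => match fintype.split i with inl j => a1 j | inr j => - a2 j end).
split=> [i|]; first by case: fintype.split => j; [exact: h1|exact: h2].
rewrite big_split_ord/= -sumrN; congr (_ + _); apply: eq_bigr => i _.
  by rewrite (unsplitK (inl i)).
by rewrite (unsplitK (inr i)) mulrNz.
Qed.

HB.instance Definition _ (R : realType) d :=
  GRing.isZmodClosed.Build _ (@polytope_measure_pred R d)
    (@polytope_measure_zmod_closed R d).

Record polytope_measure (R : realType) d := PolytopeMeasure {
  polytope_measure_val : borel_set R d -> R;
  _ : polytope_measure_val \in @polytope_measure_pred R d }.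

HB.instance Definition _ (R : realType) d :=
  [isSub for @polytope_measure_val R d].
HB.instance Definition _ (R : realType) d :=
  [Choice of polytope_measure R d by <:].
HB.instance Definition _ (R : realType) d :=
  [SubChoice_isSubZmodule of polytope_measure R d by <:].

Fact simplex_measure_subproof (R : realType) d (v : 'I_d.+1 -> 'rV[R]_d) :
  noncodegenerate_simplex v ->
  lebesgue_on (hull v) \in @polytope_measure_pred R d.
Proof.
move=> [vfree vnc]; apply/asboolP; exists 1, (fun=> hull v), (fun=> 1).
split=> [_|]; last by rewrite big_ord1.
split=> //; exists 1, (fun=> hull v); split=> [_|]; last first.
  by apply/seteqP; split=> [x vx|x []//]; exists ord0.
split; first by exists d.+1, v.
exists v; split=> // i; exists (fun j => (j == i)%:R); split=> [j||].
- exact: ler0n.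
- by rewrite (bigD1 i)//= eqxx big1 ?addr0// => j /negPf ->.
- rewrite (bigD1 i)//= eqxx scale1r big1 ?addr0// => j /negPf ->.
  exact: scale0r.
Qed.

Definition simplex_measure (R : realType) d (v : 'I_d.+1 -> 'rV[R]_d)
    (hv : noncodegenerate_simplex v) : polytope_measure R d :=
  PolytopeMeasure (simplex_measure_subproof hv).

Definition signed_simplex_measures (R : realType) d :
    set (polytope_measure R d) :=
  [set x | exists (b : bool) v (hv : noncodegenerate_simplex v),
     x = simplex_measure hv *~ (-1) ^+ b].

Arguments signed_simplex_measures R d : clear implicits.

(* Main.v *)
Require Import Defs.
From mathcomp Require Import all_boot all_order all_algebra.
From mathcomp Require Import all_classical all_reals all_analysis.
From mathcomp Require Import measurable_realfun.
From mathcomp Require Import ring lra.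

(** Everything reduces to identities between indicator functions that hold off
    finitely many hyperplanes, and these are checked with homogeneous
    coordinates: a point x of the d-space becomes hat x = (1, x), a simplex
    becomes a basis of the (d+1)-space, and coor B q j is the j-th barycentric
    coordinate of q. Let lam_j be the barycentric coordinates of the origin in
    a simplex with vertices v_j. The simplex is non-codegenerate when no lam_j
    vanishes, the sign of lam_j tells on which side of the j-th facet the
    origin lies, and the barycentric coordinates of y in the polar simplex are
    lam_j (1 - <y, v_j>). So the polar simplex has the same lam_j, and polarity
    is an involution that preserves sigma.

    Well-definedness is the heart of the matter: a relation
    sum_i m_i [Delta_i] = 0 implies the signed relation between the polars.
    For fixed generic y, let the flip of a simplicial cone at a level tau
    replace every generator b of height <b, y> > tau by its opposite and
    multiply the indicator by -1 for each generator replaced. At tau = 1 the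
    flipped indicator, evaluated at the origin hat 0, is
    (-1)^sigma times the indicator at y of the polar simplex. For large tau
    nothing is flipped and the sum vanishes by hypothesis. When tau decreases
    past the height of a vertex b, the sum changes by a function that is
    invariant under translation along b, because a cone plus its reflection is
    a cone with the line R b added; but the sum before the crossing is zero
    and the sum after it is supported in a half-space that b leaves, so the
    change is zero (flip_sum_eq0, polar_relation).

    Generation: by Caratheodory a polytope is, up to hyperplanes, a finite
    union of simplices, and cutting simplices by hyperplanes shows that its
    indicator is an integral combination of indicators of simplices
    (polytope_simplex_span). Coning every simplex from one generic point p
    (the stellar identity) rewrites it with simplices p * F, F a facet. Those
    for which F is not coplanar with the origin are non-codegenerate. The
    remaining ones, grouped by the hyperplane K of F, add up to the jump of
    the indicator of the polytope across K at generic points of K; if this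
    jump were not zero, K would be a facet hyperplane through the origin
    (side_eq, bad_facets_cancel).

    Measures enter only through two facts: hyperplanes are null, and boxes
    have positive finite measure; hence a combination of simplex measures
    vanishes if and only if the combination of indicators vanishes off
    finitely many hyperplanes (comb_eq0). *)

Set Implicit Arguments.
Unset Strict Implicit.
Unset Printing Implicit Defensive.

Import Order.TTheory GRing.Theory Num.Theory.
Import numFieldNormedType.Exports.
Local Open Scope classical_set_scope.
Local Open Scope ring_scope.

(** * The standard pairing, homogeneous coordinates and bases *)

Section dot_theory.
Context {R : realType} {n : nat}.
Implicit Types u v w : 'rV[R]_n.

Lemma dotC u v : dot u v = dot v u.
Proof. by apply: eq_bigr => i _; rewrite mulrC. Qed.

Lemma dotDl u v w : dot (u + v) w = dot u w + dot v w.
Proof. by rewrite -big_split; apply: eq_bigr => i _; rewrite mxE mulrDl. Qed.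

Lemma dotZl a u w : dot (a *: u) w = a * dot u w.
Proof. by rewrite mulr_sumr; apply: eq_bigr => i _; rewrite mxE mulrA. Qed.

Lemma dot0l w : dot 0 w = 0.
Proof. by apply: big1 => i _; rewrite mxE mul0r. Qed.

Lemma dotNl u w : dot (- u) w = - dot u w.
Proof. by rewrite -scaleN1r dotZl mulN1r. Qed.

Lemma dotBl u v w : dot (u - v) w = dot u w - dot v w.
Proof. by rewrite dotDl dotNl. Qed.

Lemma dotDr w u v : dot w (u + v) = dot w u + dot w v.
Proof. by rewrite dotC dotDl ![dot _ w]dotC. Qed.

Lemma dotZr a w u : dot w (a *: u) = a * dot w u.
Proof. by rewrite dotC dotZl dotC. Qed.

Lemma dot0r w : dot w 0 = 0.
Proof. by rewrite dotC dot0l. Qed.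

Lemma dotNr w u : dot w (- u) = - dot w u.
Proof. by rewrite dotC dotNl dotC. Qed.

Lemma dotBr w u v : dot w (u - v) = dot w u - dot w v.
Proof. by rewrite dotDr dotNr. Qed.

Lemma dot_suml (I : Type) (r : seq I) (P : pred I) (F : I -> 'rV[R]_n) w :
  dot (\sum_(i <- r | P i) F i) w = \sum_(i <- r | P i) dot (F i) w.
Proof. by elim/big_rec2: _ => [|i y1 y2 _ <-]; rewrite ?dot0l ?dotDl. Qed.

Lemma dot_sumr (I : Type) (r : seq I) (P : pred I) (F : I -> 'rV[R]_n) w :
  dot w (\sum_(i <- r | P i) F i) = \sum_(i <- r | P i) dot w (F i).
Proof. by rewrite dotC dot_suml; apply: eq_bigr => i _; rewrite dotC. Qed.

Lemma dot_delta u (i : 'I_n) : dot u (delta_mx 0 i) = u ord0 i.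
Proof.
rewrite /dot (bigD1 i)//= mxE !eqxx mulr1 big1 ?addr0// => j /negPf ji.
by rewrite mxE ji andbF mulr0.
Qed.

Lemma dot_neq0_ex u : u != 0 -> exists i, u ord0 i != 0.
Proof.
move=> /eqP u0; apply/existsP; apply: contra_notT u0 => /existsPn h.
by apply/rowP => i; have := h i; rewrite negbK mxE => /eqP.
Qed.

Lemma dot_trmx_col m u (A : 'M[R]_(n, m)) j : dot u (col j A)^T = (u *m A) ord0 j.
Proof. by rewrite mxE; apply: eq_bigr => i _; rewrite !mxE. Qed.

End dot_theory.

Section hat.
Context {R : realType} {d : nat}.
Implicit Types x y : 'rV[R]_d.

(** Homogenization: affine forms on the d-space become linear forms on the
    (d+1)-space, so one kind of hyperplane suffices. *)
Definition hat x : 'rV[R]_d.+1 :=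
  \row_j oapp (x ord0) 1 (unlift ord0 j).

Definition tail (q : 'rV[R]_d.+1) : 'rV[R]_d := \row_j q ord0 (lift ord0 j).

Lemma hat0E x : hat x ord0 ord0 = 1.
Proof. by rewrite mxE unlift_none. Qed.

Lemma hatSE x j : hat x ord0 (lift ord0 j) = x ord0 j.
Proof. by rewrite mxE liftK. Qed.

Lemma dot_split (q l : 'rV[R]_d.+1) :
  dot q l = q ord0 ord0 * l ord0 ord0 + dot (tail q) (tail l).
Proof.
rewrite /dot big_ord_recl; congr (_ + _).
by apply: eq_bigr => i _; rewrite !mxE.
Qed.

Lemma tail_hat x : tail (hat x) = x.
Proof. by apply/rowP => j; rewrite mxE hatSE. Qed.

Lemma dot_hat x l : dot (hat x) l = l ord0 ord0 + dot x (tail l).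
Proof. by rewrite dot_split hat0E mul1r tail_hat. Qed.

Lemma tailD (q r : 'rV[R]_d.+1) : tail (q + r) = tail q + tail r.
Proof. by apply/rowP => j; rewrite !mxE. Qed.

Lemma tailZ a (q : 'rV[R]_d.+1) : tail (a *: q) = a *: tail q.
Proof. by apply/rowP => j; rewrite !mxE. Qed.

Lemma hat_ext (q : 'rV[R]_d.+1) : q ord0 ord0 = 1 -> hat (tail q) = q.
Proof.
move=> q1; apply/rowP => j; case: (unliftP ord0 j) => [k|] ->.
  by rewrite hatSE mxE.
by rewrite hat0E.
Qed.

Lemma rV_split_ext (q r : 'rV[R]_d.+1) :
  q ord0 ord0 = r ord0 ord0 -> tail q = tail r -> q = r.
Proof.
move=> h0 ht; apply/rowP => j; case: (unliftP ord0 j) => [k|] -> //.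
by have /rowP/(_ k) := ht; rewrite !mxE.
Qed.

Lemma hat_inj : injective hat.
Proof. by move=> x y /(congr1 tail); rewrite !tail_hat. Qed.

Lemma hat_segment e x y :
  hat ((1 - e) *: x + e *: y) = (1 - e) *: hat x + e *: hat y.
Proof.
apply: rV_split_ext; last by rewrite tailD !tailZ !tail_hat.
by rewrite hat0E !mxE !unlift_none/= !mulr1 subrK.
Qed.

Lemma hat_homog (q : 'rV[R]_d.+1) : q ord0 ord0 != 0 ->
  hat ((q ord0 ord0)^-1 *: tail q) = (q ord0 ord0)^-1 *: q.
Proof. by move=> q0; rewrite -tailZ hat_ext// mxE mulVf. Qed.

End hat.

Section coordinates.
Context {R : realType} {n : nat}.
Implicit Types (B : 'M[R]_n) (q : 'rV[R]_n).

(** The linear form computing the j-th coordinate in the basis formed by the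
    rows of B. *)
Definition cform B j : 'rV[R]_n := (col j (invmx B))^T.

Definition coor B q j : R := dot q (cform B j).

Lemma coorE B q j : coor B q j = (q *m invmx B) ord0 j.
Proof. exact: dot_trmx_col. Qed.

Lemma coorD B q r j : coor B (q + r) j = coor B q j + coor B r j.
Proof. exact: dotDl. Qed.

Lemma coorZ B a q j : coor B (a *: q) j = a * coor B q j.
Proof. exact: dotZl. Qed.

Lemma coorB B q r j : coor B (q - r) j = coor B q j - coor B r j.
Proof. exact: dotBl. Qed.

Lemma coor_row B i j : B \in unitmx -> coor B (row i B) j = (i == j)%:R.
Proof. by move=> uB; rewrite coorE -row_mul mulmxV// !mxE. Qed.

Lemma coor_sum B q : B \in unitmx -> q = \sum_j coor B q j *: row j B.
Proof.
move=> uB; rewrite -[LHS](mulmxKV uB) mulmx_sum_row.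
by apply: eq_bigr => j _; rewrite coorE.
Qed.

Lemma coor_uniq B q (a : 'I_n -> R) j : B \in unitmx ->
  q = \sum_i a i *: row i B -> coor B q j = a j.
Proof.
move=> uB ->; rewrite /coor dot_suml (bigD1 j)//= dotZl.
have E i : dot (row i B) (cform B j) = (i == j)%:R by exact: coor_row.
rewrite E eqxx mulr1 big1 ?addr0// => i /negPf ij.
by rewrite dotZl E ij mulr0.
Qed.

Lemma cform_neq0 B j : B \in unitmx -> cform B j != 0.
Proof.
move=> uB; apply/eqP => B0; have := coor_row j j uB.
by rewrite /coor B0 dot0r eqxx => /esym/eqP; rewrite oner_eq0.
Qed.

Lemma row_inj_unit B i j : B \in unitmx -> row i B = row j B -> i = j.
Proof.
move=> uB E; apply/eqP; have := coor_row i j uB; rewrite E coor_row// eqxx.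
by case: eqP => // _ /eqP; rewrite oner_eq0.
Qed.

(** Coordinate forms are linearly independent; this is what makes all the
    genericity conditions below nontrivial. *)
Lemma cform_comb_neq0 B (a b : R) i j : B \in unitmx -> i != j ->
  (a != 0) || (b != 0) -> a *: cform B i + b *: cform B j != 0.
Proof.
move=> uB ij ab; apply/eqP => E.
have h k : a * (k == i)%:R + b * (k == j)%:R = 0.
  by rewrite -!(coor_row k _ uB) -!dotZr -dotDr E dot0r.
move: ab (h i) (h j); rewrite !eqxx (eq_sym j) (negPf ij) !mulr1 !mulr0.
by rewrite addr0 add0r => /orP[] /eqP.
Qed.

End coordinates.

(** * Properties that hold off finitely many hyperplanes *)

Section generic.
Context {R : realType}.

Definition avoids n (L : seq 'rV[R]_n) (q : 'rV[R]_n) : bool :=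
  all (fun l => dot q l != 0) L.

(** The filter of the properties of t that hold as soon as f t avoids some
    finite list of linear hyperplanes. Such properties can be tested along
    a line or on one side of a hyperplane, which almost-everywhere
    statements do not allow. *)
Definition off_planes T n (f : T -> 'rV[R]_n) : set_system T :=
  [set P | exists2 L : seq 'rV[R]_n, 0 \notin L &
     forall x, avoids L (f x) -> P x].

Global Instance off_planes_filter T n (f : T -> 'rV[R]_n) :
  Filter (off_planes f).
Proof.
split.
- by exists [::].
- move=> P Q [L L0 hP] [K K0 hQ]; exists (L ++ K).
    by rewrite mem_cat negb_or L0.
  by move=> x; rewrite /avoids all_cat => /andP[/hP ? /hQ].
- by move=> P Q PQ [L L0 hP]; exists L => // x /hP/PQ.
Qed.

Definition generic {n} : set_system 'rV[R]_n := off_planes id.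
(** A form whose linear part vanishes but whose constant term does not is
    allowed here: it never vanishes on the image of hat. *)
Definition affine_generic {d} : set_system 'rV[R]_d := off_planes hat.

Lemma off_planes_form T n (f : T -> 'rV[R]_n) l : l != 0 ->
  \forall x \near off_planes f, dot (f x) l != 0.
Proof.
by move=> l0; exists [:: l]; rewrite ?inE 1?eq_sym// => x; rewrite /avoids/= andbT.
Qed.

Lemma generic_hat d (P : 'rV[R]_d.+1 -> Prop) :
  (\forall q \near generic, P q) -> \forall x \near affine_generic, P (hat x).
Proof. by move=> [L L0 h]; exists L => // x /h. Qed.

Lemma line_neq0 (a b : R) : b != 0 -> \forall e \near 0^', (1 - e) * a + e * b != 0.
Proof.
move=> b0; have [->|a0] := eqVneq a 0.
  near=> e; rewrite mulr0 add0r mulf_neq0//; near: e; exact: nbhs_dnbhs_neq.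
apply: nbhs_dnbhs; have c : continuous (fun e : R => (1 - e) * a + e * b).
  move=> e; apply: cvgD; apply: cvgM => //; try exact: cvg_cst.
  by apply: cvgB => //; exact: cvg_cst.
have := c 0; rewrite /continuous_at subr0 mul1r mul0r addr0.
by move/cvgr_neq0; apply.
Unshelve. all: by end_near. Qed.

(** A segment starting anywhere and pointing towards a point off the
    hyperplanes leaves all of them immediately. *)
Lemma avoids_segment n (L : seq 'rV[R]_n) y r : avoids L r ->
  \forall e \near (0:R)^', avoids L ((1 - e) *: y + e *: r).
Proof.
elim: L => [_|l L IH /= /andP[lr /IH hL]]; first by near=> e.
have hl := line_neq0 (dot y l) lr.
near=> e; apply/andP; split; last by near: e.
by rewrite dotDl !dotZl; near: e.
Unshelve. all: by end_near. Qed.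

(** Generic points accumulate at every point y, along the line through almost
    every r, on both sides of y. *)
Lemma affine_generic_segment d (P : 'rV[R]_d -> Prop) y :
  (\forall x \near affine_generic, P x) ->
  \forall r \near affine_generic, \forall e \near (0:R)^', P ((1 - e) *: y + e *: r).
Proof.
move=> [L L0 h]; exists L => // r /(@avoids_segment _ _ (hat y)).
by apply: filterS => e; rewrite -hat_segment; exact: h.
Qed.

Lemma form_neq0_ex d (l : 'rV[R]_d.+1) : l != 0 -> exists x, dot (hat x) l != 0.
Proof.
move=> l0; have [l00|] := eqVneq (l ord0 ord0) 0; last first.
  by exists 0; rewrite dot_hat dot0l addr0.
have /dot_neq0_ex[k] : tail l != 0.
  apply: contra_neq l0 => t0; apply: rV_split_ext; first by rewrite l00 mxE.
  by rewrite t0; apply/rowP => j; rewrite !mxE.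
rewrite -dot_delta dotC => lk; exists (delta_mx 0 k).
by rewrite dot_hat l00 add0r.
Qed.

Global Instance affine_generic_proper d : ProperFilter (@affine_generic d).
Proof.
apply: Build_ProperFilter_ex => P [L L0 h].
suff [x hx] : exists x, avoids L (hat x) by exists x; exact: h.
elim: L L0 {P h} => [|l L IH]; first by exists 0.
rewrite inE negb_or eq_sym => /andP[/form_neq0_ex[y hy] /IH[r hr]].
have hl : avoids [:: l] (hat y) by rewrite /avoids/= hy.
have h1 := avoids_segment (hat y) hr.
have [e] : exists e : R, avoids L ((1 - e) *: hat y + e *: hat r) /\
    avoids [:: l] ((1 - e) *: hat y + e *: hat r).
  apply: (@filter_ex _ (0:R)^'); apply: filterI => //.
  have c : continuous (fun e : R => (1 - e) * dot (hat y) l + e * dot (hat r) l).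
    move=> e; apply: cvgD; apply: cvgM => //; try exact: cvg_cst.
    by apply: cvgB => //; exact: cvg_cst.
  apply: nbhs_dnbhs; have := c 0.
  rewrite /continuous_at subr0 mul1r mul0r addr0.
  move=> /cvgr_neq0/(_ hy); apply: filterS => e.
  by rewrite /avoids/= andbT dotDl !dotZl.
rewrite -hat_segment => -[h2 h3]; exists ((1 - e) *: y + e *: r).
by apply/andP; split=> //; move: h3; rewrite /avoids/= andbT.
Qed.

(** On a line not contained in a hyperplane each form vanishes at most once, so
    generic points remain generic under all large translations. *)
Lemma generic_shift n (P : 'rV[R]_n -> Prop) b :
  (\forall q \near generic, P q) ->
  \forall q \near generic, \forall k \near +oo, P (q + k *: b).
Proof.
move=> [L L0 h]; exists L => // q; rewrite /= => aq.
suff : \forall k \near +oo, avoids L (q + k *: b) by apply: filterS => k /h.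
elim: L L0 {h} aq => [_ _|l L IH]; first by near=> k.
rewrite inE negb_or => /andP[_ /IH{}IH] /= /andP[ql /IH{}IH].
near=> k; apply/andP; split; last by near: k.
rewrite dotDl dotZl; have [->|b0] := eqVneq (dot b l) 0.
  by rewrite mulr0 addr0.
have : k > - dot q l / dot b l by near: k; apply: nbhs_pinfty_gt; exact: num_real.
apply: contraTneq => E; suff -> : k = - dot q l / dot b l by rewrite ltxx.
by apply: (mulIf b0); rewrite mulfVK//; lra.
Unshelve. all: by end_near. Qed.

End generic.

(** * Flipping simplicial cones across walls *)

Section flip.
Context {R : realType} {n : nat}.
Implicit Types (B : 'M[R]_n) (q : 'rV[R]_n) (T : pred 'rV[R]_n).

Definition inside B q : bool := [forall j, 0 < coor B q j].

(** The indicator of the simplicial cone whose generators in T are replaced by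
    their opposites, with sign (-1) to the number of generators replaced.
    *)
Definition flip T B q : R :=
  \prod_j (if T (row j B) then - (coor B q j < 0)%R%:R else (0 < coor B q j)%R%:R).

Lemma prod_bool (I : finType) (b : pred I) :
  \prod_j (b j)%:R = [forall j, b j]%:R :> R.
Proof.
case: forallP => [h|/forallP]; first by rewrite big1// => j _; rewrite h.
rewrite negb_forall => /existsP[j /negPf bj].
by rewrite (bigD1 j)//= bj mul0r.
Qed.

Lemma flip_none T B q : (forall j, ~~ T (row j B)) -> flip T B q = (inside B q)%:R.
Proof.
move=> h; rewrite -prod_bool; apply: eq_bigr => j _.
by rewrite (negPf (h j)).
Qed.

(** Flipping the single generator b changes the function by the indicator of a
    cone that contains the line spanned by b, whence the invariance along
    b. *)
Lemma flip_cross B b T T' q k : B \in unitmx ->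
  ~~ T b -> T' b -> (forall j, row j B != b -> T' (row j B) = T (row j B)) ->
  (forall j, coor B q j != 0) -> (forall j, coor B (q + k *: b) j != 0) ->
  flip T' B q - flip T B q = flip T' B (q + k *: b) - flip T B (q + k *: b).
Proof.
move=> uB Tb T'b TT' q0 qk0.
have [/existsP[j /eqP jb]|] := boolP [exists j, row j B == b]; last first.
  rewrite negb_exists => /forallP h.
  have E x : flip T' B x = flip T B x.
    by apply: eq_bigr => j _; rewrite TT'.
  by rewrite !E !subrr.
have cross x : (forall j, coor B x j != 0) -> flip T' B x - flip T B x =
    - \prod_(i | i != j) (if T (row i B) then - (coor B x i < 0)%R%:R
                          else (0 < coor B x i)%R%:R).
  move=> x0; rewrite /flip (bigD1 j)//= [X in _ - X](bigD1 j)//= jb T'b (negPf Tb).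
  rewrite (eq_bigr (fun i => if T (row i B) then - (coor B x i < 0)%R%:R
    else (0 < coor B x i)%R%:R)); last first.
    move=> i ij; rewrite TT'//; apply: contra_neq ij => ib.
    by apply: (row_inj_unit uB); rewrite ib.
  by have := x0 j; case: ltrgt0P => // _ _; rewrite ?oppr0 ?mul0r ?mulN1r ?mul1r ?subr0 ?sub0r.
rewrite !cross//; congr (- _); apply: eq_bigr => i ij.
rewrite coorD coorZ -jb coor_row// (eq_sym j) (negPf ij) mulr0 addr0//.
Qed.

(** In the flipped cone every generator has a nonnegative value under the form
    tau h - g, hence so has every point. *)
Lemma flip_support B (h g : 'rV[R]_n) tau q : B \in unitmx ->
  (forall j, dot (row j B) h = 1) ->
  flip (fun b => tau < dot b g) B q != 0 -> dot q g <= tau * dot q h.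
Proof.
move=> uB h1 /prodf_neq0 nz.
rewrite -subr_ge0 -dotZr -dotBr {1}(coor_sum q uB) dot_suml sumr_ge0// => j _.
rewrite dotZl dotBr dotZr h1 mulr1.
have := nz j isT; case: ltP => hj; rewrite ?oppr_eq0 pnatr_eq0 eqb0 negbK => c.
  by rewrite -mulrNN mulr_ge0// ?oppr_ge0 ?subr_le0 ltW.
by rewrite mulr_ge0// ?subr_ge0// ltW.
Qed.

Lemma coor_neq0_generic B : B \in unitmx ->
  \forall q \near generic, forall j, coor B q j != 0.
Proof.
move=> uB; apply: filter_forall => j.
by apply: (@off_planes_form _ _ _ id); exact: cform_neq0.
Qed.

(** Induction on the number of generators above the level tau. Let b be the
    lowest of them. By induction at the height of b the sum vanishes as
    long as b is not flipped. Flipping b changes the sum by a function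
    invariant along b, and far away along b the new sum vanishes too, being
    supported in a half-space that b leaves. *)
Lemma flip_sum_eq0 (I : finType) (m : I -> R) (B : I -> 'M[R]_n)
    (h g : 'rV[R]_n) :
  (forall i, B i \in unitmx) ->
  (forall i j, dot (row j (B i)) h = 1) ->
  (forall i j i' j', dot (row j (B i)) g = dot (row j' (B i')) g ->
     row j (B i) = row j' (B i')) ->
  (\forall q \near generic, \sum_i m i * (inside (B i) q)%:R = 0) ->
  forall tau, \forall q \near generic,
    \sum_i m i * flip (fun b => tau < dot b g) (B i) q = 0.
Proof.
move=> uB Bh ginj hyp tau.
have [N] := ubnP #|[pred a : I * 'I_n | tau < dot (row a.2 (B a.1)) g]|.
elim: N => // N IH in tau *; rewrite ltnS => leN.
have [/existsP[a0 ha0]|] :=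
    boolP [exists a : I * 'I_n, tau < dot (row a.2 (B a.1)) g]; last first.
  rewrite negb_exists => /forallP none; apply: filterS hyp => q hq; rewrite -[RHS]hq.
  by apply: eq_bigr => i _; rewrite flip_none// => j; exact: (none (i, j)).
have [/= [i0 j0] /= ha amin] := @arg_minP _ R (I * 'I_n)%type a0
  (fun a => tau < dot (row a.2 (B a.1)) g) (fun a => dot (row a.2 (B a.1)) g) ha0.
set b := row j0 (B i0); rewrite -/b in ha amin.
pose F t q := \sum_i m i * flip (fun b => t < dot b g) (B i) q.
have Fb : \forall q \near generic, F (dot b g) q = 0.
  apply: IH; apply: leq_trans leN; apply: proper_card; apply/properP; split.
    by apply/fintype.subsetP => a; rewrite !inE => /(lt_trans ha).
  by exists (i0, j0); rewrite !inE//= ltxx.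
have nz : \forall q \near generic, forall i j, coor (B i) q j != 0.
  by apply: filter_forall => i; exact: coor_neq0_generic.
have nzk := generic_shift b nz.
have Fbk := generic_shift b Fb.
rewrite -/(F tau); near=> q.
have q0 : forall i j, coor (B i) q j != 0 by near: q.
have Fq0 : F (dot b g) q = 0 by near: q.
have : \forall k \near (+oo : set_system R),
    [/\ forall i j, coor (B i) (q + k *: b) j != 0, F (dot b g) (q + k *: b) = 0
     & (tau * dot q h - dot q g) / (dot b g - tau) < k].
  near=> k; split; [near: k|near: k|near: k].
  - by near: q.
  - by near: q.
  - by apply: nbhs_pinfty_gt; exact: num_real.
move=> /filter_ex[k [qk0 Fk0 kbig]].
have E : F tau q - F (dot b g) q =
         F tau (q + k *: b) - F (dot b g) (q + k *: b).
  rewrite -!sumrB; apply: eq_bigr => i _; rewrite -!mulrBr; congr (_ * _).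
  apply: flip_cross => //=; rewrite ?ltxx// => j jb.
  apply/idP/idP => [hj|/(lt_trans ha)//]; rewrite lt_neqAle (amin (i, j))// andbT.
  by apply: contra_neq jb => /esym /ginj.
move: E; rewrite Fq0 Fk0 !subr0 => E; rewrite -[LHS]/(F tau q) E /F big1// => i _.
apply/eqP; rewrite mulf_eq0; apply/orP; right; apply: contraLR kbig => nz0.
have := flip_support (uB i) (Bh i) nz0; rewrite -leNgt !dotDl !dotZl.
rewrite {2}/b Bh ler_pdivlMr ?subr_gt0//; lra.
Unshelve. all: by end_near. Qed.

End flip.

(** * Simplices, their facets and their polars *)

Section simplex.
Context {R : realType} {d : nat}.
Implicit Types (v w : 'I_d.+1 -> 'rV[R]_d) (x y : 'rV[R]_d).

Definition vertex_mx v : 'M[R]_d.+1 := \matrix_i hat (v i).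

Lemma row_vertex_mx v i : row i (vertex_mx v) = hat (v i).
Proof. by rewrite rowK. Qed.

Lemma tail_sum (I : finType) (F : I -> 'rV[R]_d.+1) :
  tail (\sum_i F i) = \sum_i tail (F i).
Proof.
by apply/rowP => j; rewrite mxE !summxE; apply: eq_bigr => i _; rewrite mxE.
Qed.

Lemma comb_vertex_mx00 v (a : 'I_d.+1 -> R) :
  (\sum_i a i *: row i (vertex_mx v)) ord0 ord0 = \sum_i a i.
Proof.
by rewrite summxE; apply: eq_bigr => i _; rewrite row_vertex_mx mxE hat0E mulr1.
Qed.

Lemma tail_comb_vertex_mx v (a : 'I_d.+1 -> R) :
  tail (\sum_i a i *: row i (vertex_mx v)) = \sum_i a i *: v i.
Proof.
by rewrite tail_sum; apply: eq_bigr => i _; rewrite row_vertex_mx tailZ tail_hat.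
Qed.

Lemma affinely_independentP v : affinely_independent v <-> vertex_mx v \in unitmx.
Proof.
split=> [vfree|uv a a0 av0 i].
  rewrite -row_free_unit; apply: inj_row_free => a.
  rewrite mulmx_sum_row => a0; apply/rowP => i; rewrite [RHS]mxE.
  apply: (vfree (a ord0)); first by rewrite -(comb_vertex_mx00 v) a0 mxE.
  by rewrite -tail_comb_vertex_mx a0; apply/rowP => j; rewrite !mxE.
have E : 0 = \sum_i a i *: row i (vertex_mx v).
  apply: rV_split_ext; rewrite ?comb_vertex_mx00 ?a0 ?mxE// tail_comb_vertex_mx av0.
  by apply/rowP => j; rewrite !mxE.
by rewrite -(coor_uniq i uv E) /coor dot0l.
Qed.

Lemma sum_coor v q : vertex_mx v \in unitmx ->
  \sum_j coor (vertex_mx v) q j = q ord0 ord0.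
Proof. by move=> uv; rewrite [in RHS](coor_sum q uv) comb_vertex_mx00. Qed.

Lemma sum_coor_vertex v x : vertex_mx v \in unitmx ->
  \sum_j coor (vertex_mx v) (hat x) j *: v j = x.
Proof. by move=> uv; rewrite -tail_comb_vertex_mx -coor_sum// tail_hat. Qed.

Lemma coor_vertex v i j : vertex_mx v \in unitmx ->
  coor (vertex_mx v) (hat (v i)) j = (i == j)%:R.
Proof. by move=> uv; rewrite -row_vertex_mx coor_row. Qed.

Lemma coor_hat v x j : coor (vertex_mx v) (hat x) j =
  coor (vertex_mx v) (hat 0) j + dot x (tail (cform (vertex_mx v) j)).
Proof. by rewrite /coor !dot_hat dot0l addr0. Qed.

Lemma hat_comb v (a : 'I_d.+1 -> R) : \sum_i a i = 1 ->
  hat (\sum_i a i *: v i) = \sum_i a i *: row i (vertex_mx v).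
Proof. by move=> a1; rewrite -tail_comb_vertex_mx hat_ext// comb_vertex_mx00. Qed.

Lemma hullP v x : vertex_mx v \in unitmx ->
  hull v x <-> forall j, 0 <= coor (vertex_mx v) (hat x) j.
Proof.
move=> uv; split=> [[a [a0 a1 ->]] j|h].
  by rewrite (@coor_uniq _ _ _ _ a)// hat_comb.
exists (coor (vertex_mx v) (hat x)); split => //; first by rewrite sum_coor// hat0E.
by rewrite sum_coor_vertex.
Qed.

Lemma hull_inside v x : vertex_mx v \in unitmx ->
  (forall j, coor (vertex_mx v) (hat x) j != 0) ->
  (x \in hull v) = inside (vertex_mx v) (hat x).
Proof.
move=> uv x0; apply/idP/forallP => [|h].
  by rewrite inE => /hullP h j; rewrite lt_neqAle eq_sym x0 h.
by rewrite inE hullP// => j; exact/ltW.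
Qed.

Lemma hull_inside_generic v : vertex_mx v \in unitmx ->
  \forall x \near affine_generic, (x \in hull v) = inside (vertex_mx v) (hat x).
Proof.
move=> uv; have := generic_hat (coor_neq0_generic uv).
by apply: filterS => x; exact: hull_inside.
Qed.

Lemma dot_hat_continuous (l : 'rV[R]_d.+1) :
  continuous (fun x : 'rV[R]_d => dot (hat x) l).
Proof.
have cdot u : continuous (fun x : 'rV[R]_d => dot x u).
  rewrite /dot; elim: (index_enum _) => [|i r IH] x.
    by under eq_fun do rewrite big_nil; exact: cst_continuous.
  under eq_fun do rewrite big_cons.
  apply: (@continuousD _ _ _ (fun x : 'rV[R]_d => x ord0 i * u ord0 i)); last exact: IH.
  apply: (@continuousM _ _ (fun x : 'rV[R]_d => x ord0 i)); last exact: cst_continuous.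
  exact: coord_continuous.
under eq_fun do rewrite dot_hat.
move=> x; apply: (@continuousD _ _ _ (fun _ : 'rV[R]_d => l ord0 ord0) (fun x => dot x (tail l))); last exact: cdot.
exact: cst_continuous.
Qed.

Lemma dot_hat_gt0_near (l : 'rV[R]_d.+1) (x : 'rV[R]_d) : 0 < dot (hat x) l ->
  \forall y \near x, 0 < dot (hat y) l.
Proof. by move=> x0; have /cvgr_gt := @dot_hat_continuous l x; exact. Qed.

Lemma dot_hat_lt0_near (l : 'rV[R]_d.+1) (x : 'rV[R]_d) : dot (hat x) l < 0 ->
  \forall y \near x, dot (hat y) l < 0.
Proof. by move=> x0; have /cvgr_lt := @dot_hat_continuous l x; exact. Qed.

Lemma segment_near x y (W : set 'rV[R]_d) : nbhs x W ->
  \forall e \near (0 : R), W ((1 - e) *: x + e *: y).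
Proof.
have c : continuous (fun e : R => (1 - e) *: x + e *: y).
  move=> e; apply: cvgD; apply: cvgZr_tmp => //.
  by apply: cvgB => //; exact: cvg_cst.
by have := c 0; rewrite /continuous_at subr0 scale1r scale0r addr0 => /[apply].
Qed.

Lemma near_forall (I : finType) x (P : I -> set 'rV[R]_d) :
  (forall i, \forall y \near x, P i y) -> \forall y \near x, forall i, P i y.
Proof. exact: (@filter_forall _ _ P (nbhs x) _). Qed.

Lemma near_always x (P : set 'rV[R]_d) :
  (forall y, P y) -> \forall y \near x, P y.
Proof. exact: (@filterE _ (nbhs x)). Qed.

Lemma near_imply x (P Q : set 'rV[R]_d) : (forall y, P y -> Q y) ->
  (\forall y \near x, P y) -> \forall y \near x, Q y.
Proof. exact: (@filterS _ (nbhs x)). Qed.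

(** At the barycentre of the i-th facet the other coordinates are positive, so
    nearby the facet hyperplane stays in the simplex, while arbitrarily
    small steps away from the vertex v i leave it: these points are on the
    frontier. *)
Lemma codegenerate_coor0 v i : vertex_mx v \in unitmx -> (0 < d)%N ->
  coor (vertex_mx v) (hat 0) i = 0 -> codegenerate (hull v).
Proof.
move=> uv d0 li0; set l := cform (vertex_mx v) i.
have dl x : dot x (tail l) = dot (hat x) l.
  by rewrite -[RHS]/(coor _ _ _) coor_hat li0 add0r.
exists (tail l); split.
  apply: contra_neq (cform_neq0 i uv) => l0; apply: rV_split_ext.
    by have := li0; rewrite /coor dot_hat dot0l addr0 => ->; rewrite mxE.
  by rewrite -/l l0; apply/rowP => j; rewrite !mxE.
pose a (j : 'I_d.+1) : R := if j == i then 0 else d%:R^-1.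
have a1 : \sum_j a j = 1.
  rewrite (bigD1 i)//= /a eqxx add0r (eq_bigr (fun=> d%:R^-1)).
    rewrite sumr_const (_ : #|_| = d) ?cardC1 ?card_ord//.
    by rewrite -[LHS]mulr_natl mulfV// pnatr_eq0 -lt0n.
  by move=> j /negPf ->.
have ax j : coor (vertex_mx v) (hat (\sum_i a i *: v i)) j = a j.
  by apply: coor_uniq => //; rewrite hat_comb.
exists (\sum_i a i *: v i).
  by rewrite /hyperplane/= dl -[LHS]/(coor _ _ _) ax /a eqxx.
have : \forall y \near \sum_i a i *: v i, forall j : 'I_d.+1, j != i ->
    0 < coor (vertex_mx v) (hat y) j.
  apply: near_forall => j; have [->|ji] := eqVneq j i; first exact: near_always.
  have : 0 < coor (vertex_mx v) (hat (\sum_i a i *: v i)) j.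
    by rewrite ax /a (negPf ji) invr_gt0 ltr0n.
  by move=> /dot_hat_gt0_near; apply: filterS.
apply: filterS => y hy; rewrite /hyperplane/= dl -[dot _ _]/(coor _ _ _) => yi.
split; first apply: subset_closure.
  by apply/hullP => // j; have [->|/hy/ltW//] := eqVneq j i; rewrite yi.
move=> /(segment_near (v i)) h.
have : \forall e \near (0:R)^'-, hull v ((1 - e) *: y + e *: v i) /\ e < 0.
  near=> e; split; last by near: e; exact: nbhs_left_lt.
  near: e; apply: cvg_within; exact: h.
move=> /filter_ex[e [/hullP-/(_ uv i)]].
rewrite hat_segment coorD !coorZ yi coor_vertex// eqxx mulr0 add0r mulr1 leNgt => /negP.
Unshelve. all: by end_near. Qed.

(** A hyperplane through the origin that contains a piece of the frontier near
    x contains the points (1 - e) x. No coordinate vanishes at 0, hence for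
    small nonzero e none vanishes at (1 - e) x, which is thus off the
    frontier. *)
Lemma noncodegenerate_coor v : vertex_mx v \in unitmx ->
  (forall j, coor (vertex_mx v) (hat 0) j != 0) -> ~ codegenerate (hull v).
Proof.
move=> uv l0 [u [_ [x xu hx]]].
have : \forall e \near (0:R)^', frontier (hull v) ((1 - e) *: x + e *: 0)
   /\ forall j, coor (vertex_mx v) (hat ((1 - e) *: x + e *: 0)) j != 0.
  near=> e; split; near: e.
    apply: nbhs_dnbhs; apply: filterS (segment_near 0 hx) => e; apply.
    by rewrite /hyperplane/= dotDl !dotZl xu dot0l !mulr0 addr0.
  apply: filter_forall => j; apply: filterS (line_neq0 (coor (vertex_mx v) (hat x) j) (l0 j)).
  by move=> e; rewrite hat_segment coorD !coorZ.
move=> /filter_ex[e []]; set y := _ + _ => -[cly inty] y0.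
have [/forallP yin|] := boolP (inside (vertex_mx v) (hat y)).
  apply: inty; have : \forall z \near y, forall j, 0 < coor (vertex_mx v) (hat z) j.
    by apply: near_forall => j; exact: dot_hat_gt0_near (yin j).
  by apply: filterS => z hz; apply/hullP => // j; exact/ltW.
rewrite negb_forall => /existsP[j]; rewrite -leNgt le_eqVlt (negPf (y0 j))/=.
move=> /dot_hat_lt0_near/cly[z [/hullP-/(_ uv j)]].
by rewrite leNgt => /negP.
Unshelve. all: by end_near. Qed.

Lemma noncodegenerate_simplexP v : (0 < d)%N ->
  noncodegenerate_simplex v <->
  vertex_mx v \in unitmx /\ forall j, coor (vertex_mx v) (hat 0) j != 0.
Proof.
move=> d0; split=> [[/affinely_independentP uv nc]|[uv h]].
  by split=> // j; apply/eqP => /(codegenerate_coor0 uv d0).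
by split; [exact/affinely_independentP|exact: noncodegenerate_coor].
Qed.

(** An affine form vanishing on the facet opposite to v i is a multiple of the
    i-th coordinate; positivity on the simplex fixes the sign. *)
Lemma separating_facetP v i : (0 < d)%N -> vertex_mx v \in unitmx ->
  separating_facet v i <-> coor (vertex_mx v) (hat 0) i < 0.
Proof.
move=> d0 uv; split=> [[u [c [u0 uj uh]]]|li].
  rewrite dot0l => c0.
  have E : - c = coor (vertex_mx v) (hat 0) i * (dot (v i) u - c).
    have := congr1 (fun z => dot z u) (sum_coor_vertex 0 uv).
    rewrite dot0l dot_suml (bigD1 i)//= dotZl.
    rewrite (eq_bigr (fun j => coor (vertex_mx v) (hat 0) j * c)); last first.
      by move=> j /uj vj; rewrite dotZl vj.
    have := sum_coor (hat 0) uv; rewrite hat0E (bigD1 i)//= -mulr_suml.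
    set S := \sum_(_ | _) _ => h1; have -> : S = 1 - coor (vertex_mx v) (hat 0) i by lra.
    lra.
  have vi : c <= dot (v i) u.
    by apply: uh; apply/hullP => // j; rewrite coor_vertex// ler0n.
  rewrite ltNge; apply/negP => li; have : 0 <= - c by rewrite E mulr_ge0// subr_ge0.
  lra.
have [j ji] : exists j : 'I_d.+1, j != i.
  by exists (lift i (Ordinal d0)); rewrite eq_sym neq_lift.
exists (tail (cform (vertex_mx v) i)), (- coor (vertex_mx v) (hat 0) i).
have E x : dot x (tail (cform (vertex_mx v) i)) =
   coor (vertex_mx v) (hat x) i - coor (vertex_mx v) (hat 0) i by rewrite coor_hat addrC addKr.
split.
- apply/eqP => u0; have := E (v i); have := E (v j); rewrite u0 !dot0r !coor_vertex//.
  by rewrite eqxx (negPf ji)/=; lra.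
- by move=> k ki; rewrite /hyperplane/= E coor_vertex// (negPf ki) sub0r.
- by move=> x /hullP-/(_ uv i); rewrite E; lra.
- by rewrite dot0l oppr_gt0.
Qed.

Lemma sigmaE v : (0 < d)%N -> vertex_mx v \in unitmx ->
  sigma v = #|[pred i | coor (vertex_mx v) (hat 0) i < 0]|.
Proof.
move=> d0 uv; apply: eq_card => i; rewrite !inE.
by apply/asboolP/idP => /separating_facetP; apply.
Qed.

(** The polar vertices are read off the linear parts of the coordinate forms:
    the i-th coordinate is lam_i + <x, u_i>, and w_i = - u_i / lam_i. *)
Definition polar v i : 'rV[R]_d :=
  - (coor (vertex_mx v) (hat 0) i)^-1 *: tail (cform (vertex_mx v) i).

Lemma polar_polar_vertices v : vertex_mx v \in unitmx ->
  (forall j, coor (vertex_mx v) (hat 0) j != 0) -> polar_vertices v (polar v).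
Proof.
move=> uv l0 i j ji; rewrite dotC /polar dotZr.
have -> : dot (v j) (tail (cform (vertex_mx v) i)) =
   coor (vertex_mx v) (hat (v j)) i - coor (vertex_mx v) (hat 0) i by rewrite coor_hat addrC addKr.
by rewrite coor_vertex// (negPf ji) sub0r mulrNN mulVf.
Qed.

Section polar_vertices.
Variables v w : 'I_d.+1 -> 'rV[R]_d.
Hypotheses (uv : vertex_mx v \in unitmx)
  (l0 : forall j, coor (vertex_mx v) (hat 0) j != 0) (vw : polar_vertices v w).

Let lam := coor (vertex_mx v) (hat 0).

Let dot_wv i j : dot (w i) (v j) = 1 - (i == j)%:R / lam j.
Proof.
have [<-|ij] := eqVneq i j; last by rewrite vw 1?eq_sym// mul0r subr0.
apply: (mulfI (l0 i)); rewrite -/(lam i) mulrBr mulr1 div1r mulfV ?l0//.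
have := congr1 (dot (w i)) (sum_coor_vertex 0 uv).
rewrite dot0r dot_sumr (bigD1 i)//= dotZr.
rewrite (eq_bigr (fun j => lam j)); last by move=> k ki; rewrite dotZr vw// mulr1.
have := sum_coor (hat 0) uv; rewrite hat0E (bigD1 i)//=.
set S := \sum_(_ | _) _.
rewrite -/(lam i); lra.
Qed.

Lemma polar_unit : vertex_mx w \in unitmx.
Proof.
apply/affinely_independentP => a a0 aw j.
have := congr1 (fun z => dot z (v j)) aw; rewrite dot0l dot_suml.
under eq_bigr do rewrite dotZl dot_wv mulrBr mulr1.
rewrite sumrB a0 (bigD1 j)//= eqxx big1 => [|i /negPf ->]; last by rewrite mul0r mulr0.
rewrite addr0 sub0r => /eqP; rewrite oppr_eq0 div1r mulf_eq0 invr_eq0.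
by rewrite /lam (negPf (l0 j)) orbF => /eqP.
Qed.

(** The formula behind both the signed polarity and its involutivity. *)
Lemma coor_polar y j :
  coor (vertex_mx w) (hat y) j = lam j * (1 - dot y (v j)).
Proof.
rewrite -{2}(sum_coor_vertex y polar_unit) dot_suml.
under eq_bigr do rewrite dotZl dot_wv mulrBr mulr1.
rewrite sumrB sum_coor ?polar_unit// hat0E (bigD1 j)//= eqxx big1 => [|i /negPf ->].
  by rewrite addr0 div1r subKr mulrCA mulfV ?mulr1 ?l0//.
by rewrite mul0r mulr0.
Qed.

Lemma polar_coor0 j : coor (vertex_mx w) (hat 0) j = lam j.
Proof. by rewrite coor_polar dot0l subr0 mulr1. Qed.

End polar_vertices.

End simplex.

(** * Polarity preserves linear relations between simplices *)

Section relations.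
Context {R : realType} {d : nat}.
Hypothesis d0 : (0 < d)%N.
Implicit Types (v w : 'I_d.+1 -> 'rV[R]_d) (x y : 'rV[R]_d).

(** Central projection of the homogeneous space onto the affine one. *)
Lemma affine_generic_homog (P : 'rV[R]_d.+1 -> Prop) :
  (\forall x \near affine_generic, P (hat x)) ->
  {near generic, forall q : 'rV[R]_d.+1,
    q ord0 ord0 != 0 /\ P ((q ord0 ord0)^-1 *: q)}.
Proof.
move=> [L L0 h]; have e0 : delta_mx 0 ord0 != 0 :> 'rV[R]_d.+1.
  apply/eqP => /rowP/(_ ord0); rewrite !mxE !eqxx => /eqP.
  by rewrite (oner_eq0 R).
exists (delta_mx 0 ord0 :: L); first by rewrite inE eq_sym (negPf e0).
move=> q /= /andP[]; rewrite dot_delta => q0 aL; split => //.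
rewrite -hat_homog//; apply: h; rewrite hat_homog//.
by apply: sub_all aL => l l0; rewrite dotZl mulf_neq0 ?invr_eq0.
Qed.

Lemma inside_scale n (B : 'M[R]_n) a q : 0 < a -> inside B (a *: q) = inside B q.
Proof.
by move=> a0; apply: eq_forallb => j; rewrite coorZ pmulr_rgt0.
Qed.

Lemma inside_neg v (q : 'rV[R]_d.+1) : vertex_mx v \in unitmx -> q ord0 ord0 < 0 ->
  inside (vertex_mx v) q = false.
Proof.
move=> uv; rewrite -(sum_coor _ uv) => q0; apply: contraTF q0 => /forallP h.
by rewrite -leNgt sumr_ge0// => j _; exact/ltW.
Qed.

Lemma hull_sum_inside (I : finType) (m : I -> R) (v : I -> 'I_d.+1 -> 'rV[R]_d) :
  (forall i, vertex_mx (v i) \in unitmx) ->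
  \forall x \near affine_generic,
    \sum_i m i * (x \in hull (v i))%:R = \sum_i m i * (inside (vertex_mx (v i)) (hat x))%:R.
Proof.
move=> uv; have : \forall x \near affine_generic, forall i,
    (x \in hull (v i)) = inside (vertex_mx (v i)) (hat x).
  by apply: filter_forall => i; exact: hull_inside_generic.
by apply: filterS => x hx; apply: eq_bigr => i _; rewrite hx.
Qed.

(** A relation between simplices extends to the cones over them: on the half-
    space of positive first coordinate by homogeneity, on the opposite one
    because no cone meets it. *)
Lemma inside_sum_generic (I : finType) (m : I -> R) (v : I -> 'I_d.+1 -> 'rV[R]_d) :
  (forall i, vertex_mx (v i) \in unitmx) ->
  (\forall x \near affine_generic, \sum_i m i * (x \in hull (v i))%:R = 0) ->
  \forall q \near generic, \sum_i m i * (inside (vertex_mx (v i)) q)%:R = 0.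
Proof.
move=> uv hyp; have : \forall x \near affine_generic,
    \sum_i m i * (inside (vertex_mx (v i)) (hat x))%:R = 0.
  by move: hyp; apply: filterS2 (hull_sum_inside m uv) => x ->.
move=> /(@affine_generic_homog
  (fun q => \sum_i m i * (inside (vertex_mx (v i)) q)%:R = 0)); apply: filterS => q [q0 hq].
have [qpos|qneg|/eqP] := ltrgt0P (q ord0 ord0); last by rewrite (negPf q0).
  rewrite -[RHS]hq; apply: eq_bigr => i _; rewrite inside_scale//.
  by rewrite invr_gt0.
by apply: big1 => i _; rewrite inside_neg// mulr0.
Qed.

Lemma dot_hat_sub x y : dot (hat x) (hat y - hat 0) = dot x y.
Proof. by rewrite dotBr !dot_hat !tail_hat !hat0E dot0r addr0 addrC addKr. Qed.

(** Factor by factor: <v_j, y> > 1 and lam_j < 0 give -1, <v_j, y> < 1 and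
    lam_j > 0 give 1, and the two other cases give 0. *)
Lemma flip_polar v w y : vertex_mx v \in unitmx ->
  (forall j, coor (vertex_mx v) (hat 0) j != 0) -> polar_vertices v w ->
  (forall j, coor (vertex_mx w) (hat y) j != 0) ->
  flip (fun b => 1 < dot b (hat y - hat 0)) (vertex_mx v) (hat 0) =
  (-1) ^+ sigma v * (inside (vertex_mx w) (hat y))%:R.
Proof.
move=> uv l0 vw y0; rewrite sigmaE// -prod_bool -prodr_const big_mkcond/= -big_split/=.
apply: eq_bigr => j _; have := y0 j; rewrite (coor_polar uv l0 vw) mulf_eq0 negb_or.
rewrite row_vertex_mx dot_hat_sub !inE.
rewrite (dotC (v j)) => /andP[lj yj]; case: ltgtP yj => [yj|yj|->]; rewrite ?subrr ?eqxx// => _.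
  rewrite nmulr_lgt0 ?subr_lt0//; case: ifP; rewrite ?mulN1r ?mul1r ?oppr0//.
rewrite pmulr_lgt0 ?subr_gt0//; case: ltrgt0P lj => //; rewrite ?mulr0 ?mul1r//.
Qed.

(** The flipped relation holds at generic points; it is transported to the
    origin, which lies on no facet hyperplane, since flips are locally
    constant off these hyperplanes. The heights <v, y> of distinct vertices
    are distinct for generic y, as the wall crossing argument requires. *)
Lemma polar_relation (I : finType) (m : I -> R)
    (v w : I -> 'I_d.+1 -> 'rV[R]_d) :
  (forall i, vertex_mx (v i) \in unitmx) ->
  (forall i j, coor (vertex_mx (v i)) (hat 0) j != 0) ->
  (forall i, polar_vertices (v i) (w i)) ->
  (\forall x \near affine_generic, \sum_i m i * (x \in hull (v i))%:R = 0) ->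
  \forall y \near affine_generic,
    \sum_i m i * ((-1) ^+ sigma (v i) * (y \in hull (w i))%:R) = 0.
Proof.
move=> uv l0 vw /(inside_sum_generic uv) hyp.
have uw i : vertex_mx (w i) \in unitmx := polar_unit (uv i) (l0 i) (vw i).
have heights : \forall y \near (@affine_generic R d), forall i (j : 'I_d.+1) i' (j' : 'I_d.+1),
    dot (v i j) y = dot (v i' j') y -> v i j = v i' j'.
  apply: filter_forall => i; apply: filter_forall => j.
  apply: filter_forall => i'; apply: filter_forall => j'.
  have [->|vv'] := eqVneq (v i j) (v i' j'); first exact: nearW.
  have : hat (v i j) - hat (v i' j') != 0.
    by rewrite subr_eq0; apply: contra_neq vv'; exact: hat_inj.
  move=> /(off_planes_form (@hat R d)); apply: filterS => y + vyv.
  by rewrite dotBr !dot_hat !tail_hat !hat0E !(dotC y) vyv subrr eqxx.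
have nz : \forall y \near affine_generic, forall i j, coor (vertex_mx (w i)) (hat y) j != 0.
  by apply: filter_forall => i; exact: generic_hat (coor_neq0_generic (uw i)).
near=> y.
have yinj : forall i (j : 'I_d.+1) i' (j' : 'I_d.+1),
    dot (v i j) y = dot (v i' j') y -> v i j = v i' j' by near: y.
have ynz : forall i j, coor (vertex_mx (w i)) (hat y) j != 0 by near: y.
have H1 i j : dot (row j (vertex_mx (v i))) (hat 0) = 1.
  by rewrite row_vertex_mx dot_hat tail_hat dot0r hat0E addr0.
have Hinj i j i' j' : dot (row j (vertex_mx (v i))) (hat y - hat 0) =
    dot (row j' (vertex_mx (v i'))) (hat y - hat 0) ->
    row j (vertex_mx (v i)) = row j' (vertex_mx (v i')).
  by rewrite !row_vertex_mx !dot_hat_sub => /yinj ->.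
have /generic_hat := flip_sum_eq0 uv H1 Hinj hyp 1.
move=> /(affine_generic_segment 0)/filter_ex[r hr].
have polar_sign : \forall e \near (0:R)^', forall i j,
    let c := coor (vertex_mx (v i)) (hat ((1 - e) *: 0 + e *: r)) j in
    (0 < c) = (0 < coor (vertex_mx (v i)) (hat 0) j) /\
    (c < 0) = (coor (vertex_mx (v i)) (hat 0) j < 0).
  apply: filter_forall => i; apply: filter_forall => j; apply: nbhs_dnbhs.
  have := l0 i j; case: ltrgt0P => // [c0 _|c0 _].
    apply: filterS (segment_near r (dot_hat_gt0_near c0)) => e.
    rewrite -[dot _ _]/(coor _ _ _) => c /=.
    by split; [exact: c|rewrite ltNge (ltW c)].
  apply: filterS (segment_near r (dot_hat_lt0_near c0)) => e.
  rewrite -[dot _ _]/(coor _ _ _) => c /=.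
  by split; [rewrite ltNge (ltW c)|exact: c].
have [e [he0 he]] := filter_ex (filterI hr polar_sign); rewrite -[RHS]he0.
apply: eq_bigr => i _; congr (_ * _).
rewrite hull_inside// -flip_polar//; apply: eq_bigr => j _.
by have [/= -> ->] := he i j.
Unshelve. all: by end_near. Qed.

End relations.

(** * The stellar identity *)

Section stellar.
Context {R : realType} {n : nat}.
Implicit Types (B : 'M[R]_n) (p q : 'rV[R]_n).

(** With r_j = c_j / lam_j, only two terms can be nonzero: the one with
    smallest r_j among lam_j > 0, and the one with largest r_j among lam_j
    < 0. They record where the ray q - t p, t > 0, leaves and enters the
    cone. *)
Lemma stellar_count (c lam : 'I_n -> R) :
  (forall i, c i != 0) ->
  (forall i j, i != j -> lam j != 0 -> c i * lam j != c j * lam i) ->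
  (exists j, 0 < lam j) ->
  [forall i, 0 < c i]%:R = \sum_(j | lam j != 0) Num.sg (lam j) *
    ((0 < c j / lam j) && [forall i, (i != j) ==> (lam i * (c j / lam j) < c i)])%:R.
Proof.
move=> c0 cl [j0 hj0]; pose r j := c j / lam j.
pose t j := (0 < r j) && [forall i, (i != j) ==> (lam i * r j < c i)].
rewrite -[RHS]/(\sum_(j | lam j != 0) Num.sg (lam j) * (t j)%:R).
have cE i : lam i != 0 -> c i = lam i * r i by move=> li; rewrite /r mulrCA mulfV ?mulr1.
have rinj i j : i != j -> lam i != 0 -> lam j != 0 -> r i != r j.
  move=> ij li lj; apply: contra_neq (cl i j ij lj) => E.
  by rewrite (cE i)// (cE j)// E; ring.
have r0 i : lam i != 0 -> r i != 0.
  by move=> li; apply: contra_neq (c0 i) => E; rewrite (cE i)// E mulr0.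
have [/existsP[i0 /andP[/eqP li0 ci0]]|] :=
    boolP [exists i, (lam i == 0) && (c i < 0)].
  rewrite (_ : [forall i, _] = false); last first.
    by apply/forallP => /(_ i0); rewrite ltNge (ltW ci0).
  rewrite big1// => j lj; rewrite (_ : t j = false) ?mulr0//; apply/negbTE.
  rewrite negb_and negb_forall; apply/orP; right; apply/existsP; exists i0.
  rewrite li0 mul0r negb_imply -leNgt (ltW ci0) andbT.
  by apply: contra_neq lj => <-.
rewrite negb_exists => /forallP Z0.
have {Z0} Z i : lam i = 0 -> 0 < c i.
  move=> li; have := Z0 i; rewrite li eqxx/= -leNgt le_eqVlt eq_sym.
  by rewrite (negPf (c0 i)).
(* m and M below index the parameters where the ray q - t p exits and
   enters the cone. *)
have [m lm mmin] := @arg_minP _ R 'I_n j0 (fun j => 0 < lam j) r hj0.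
have posE : [forall i, 0 < c i] =
    (0 < r m) && [forall i, (lam i < 0) ==> (r i < 0)].
  apply/forallP/andP => [h|[rm /forallP rn] i].
    split; first by rewrite divr_gt0.
    apply/forallP => i; apply/implyP => li; rewrite pmulr_rlt0//.
    by rewrite invr_lt0.
  have [li|li|/Z//] := ltrgt0P (lam i).
    by rewrite (cE i) ?gt_eqF// mulr_gt0// (lt_le_trans rm)// mmin.
  by rewrite (cE i) ?lt_eqF// nmulr_rgt0//; exact: (implyP (rn i)).
have tm : t m = (0 < r m) && [forall i, (lam i < 0) ==> (r i < r m)].
  rewrite /t -/(r m); congr andb; apply/forallP/forallP => h i.
    apply/implyP => li; have im : i != m by apply: contraTneq li => ->; rewrite -leNgt ltW.
    by have := implyP (h i) im; rewrite {1}(cE i) ?lt_eqF// ltr_nM2l.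
  apply/implyP => im; have [li|li|li] := ltrgt0P (lam i).
  - rewrite {1}(cE i) ?gt_eqF// ltr_pM2l// lt_neqAle mmin// andbT.
    by apply: rinj; [rewrite eq_sym|rewrite gt_eqF|rewrite gt_eqF].
  - by rewrite {1}(cE i) ?lt_eqF// ltr_nM2l//; exact: (implyP (h i)).
  - by rewrite li mul0r; exact: Z.
have tpos j : 0 < lam j -> j != m -> t j = false.
  move=> lj jm; apply/negbTE; rewrite negb_and negb_forall; apply/orP; right.
  apply/existsP; exists m; rewrite eq_sym jm/= -/(r j) {1}(cE m) ?gt_eqF//.
  by rewrite ltr_pM2l// -leNgt mmin.
rewrite (bigD1 m) ?gt_eqF//= gtr0_sg// mul1r.
have [/existsP[i0 li0]|] := boolP [exists i, lam i < 0]; last first.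
  rewrite negb_exists => /forallP N0.
  have vac (a : R) : [forall i, (lam i < 0) ==> (r i < a)].
    by apply/forallP => i; rewrite (negPf (N0 i)).
  rewrite posE tm !vac big1 ?addr0// => j /andP[lj jm]; rewrite tpos ?mulr0//.
  by rewrite lt_neqAle eq_sym lj leNgt N0.
have [M lM Mmax] := @arg_maxP _ R 'I_n i0 (fun j => lam j < 0) r li0.
have Mm : M != m by apply: contraTneq lM => ->; rewrite -leNgt ltW.
have allneg (a : R) : [forall i, (lam i < 0) ==> (r i < a)] = (r M < a).
  apply/forallP/idP => [h|h i]; first exact: (implyP (h M)).
  by apply/implyP => li; apply: le_lt_trans h; exact: Mmax.
have tM : t M = (0 < r M) && (r M < r m).
  rewrite /t -/(r M); congr andb; apply/forallP/idP => [h|h i].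
    by have := implyP (h m); rewrite eq_sym Mm {1}(cE m) ?gt_eqF// ltr_pM2l//; apply.
  apply/implyP => iM; have [li|li|li] := ltrgt0P (lam i).
  - by rewrite {1}(cE i) ?gt_eqF// ltr_pM2l// (lt_le_trans h)// mmin.
  - rewrite {1}(cE i) ?lt_eqF// ltr_nM2l// lt_neqAle; apply/andP; split; last exact: Mmax.
    by apply: rinj => //; rewrite lt_eqF.
  - by rewrite li mul0r; exact: Z.
rewrite (bigD1 M)/=; last by rewrite Mm andbT lt_eqF.
rewrite ltr0_sg// mulN1r big1 ?addr0; last first.
  move=> j /andP[/andP[lj jm] jM]; rewrite (_ : t j = false) ?mulr0//.
  have [l0|l0|l0] := ltrgt0P (lam j); [exact: tpos| |by rewrite l0 eqxx in lj].
  apply/negbTE; rewrite negb_and negb_forall; apply/orP; right.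
  apply/existsP; exists M; rewrite eq_sym jM/= -/(r j) {1}(cE M) ?lt_eqF//.
  by rewrite ltr_nM2l// -leNgt; exact: Mmax.
rewrite posE tm tM !allneg.
have := rinj _ _ Mm (negbT (lt_eqF lM)) (negbT (gt_eqF lm)).
have := r0 _ (negbT (lt_eqF lM)); have := r0 _ (negbT (gt_eqF lm)).
case: (ltrgtP (r M) (r m)) => // h; case: (ltrgt0P (r M)) => // hM;
 case: (ltrgt0P (r m)) => // hm _ _ _; rewrite ?subrr ?subr0//; lra.
Qed.

Definition replace_row B j p : 'M[R]_n := \matrix_i (if i == j then p else row i B).

Lemma row_replace_row B j p i :
  row i (replace_row B j p) = if i == j then p else row i B.
Proof. by rewrite rowK. Qed.

Lemma coor_inj B q r : B \in unitmx -> (forall k, coor B q k = coor B r k) -> q = r.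
Proof.
move=> uB h; rewrite (coor_sum q uB) (coor_sum r uB).
by apply: eq_bigr => k _; rewrite h.
Qed.

Lemma coor_replace_comb B j p (a : 'I_n -> R) k : B \in unitmx ->
  coor B (\sum_i a i *: row i (replace_row B j p)) k =
  a j * coor B p k + (if k == j then 0 else a k).
Proof.
move=> uB; rewrite {1}/coor dot_suml (bigD1 j)//= dotZl row_replace_row eqxx.
congr (_ + _); have [->|kj] := eqVneq k j.
  rewrite big1// => i /negPf ij; rewrite dotZl row_replace_row ij.
  by rewrite -[dot _ _]/(coor B _ _) coor_row// ij mulr0.
rewrite (bigD1 k)//= dotZl row_replace_row (negPf kj) -[dot _ _]/(coor B _ _).
rewrite coor_row// eqxx mulr1 big1 ?addr0// => i /andP[/negPf ij /negPf ik].
by rewrite dotZl row_replace_row ij -[dot _ _]/(coor B _ _) coor_row// ik mulr0.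
Qed.

Lemma replace_row_unit B j p : B \in unitmx -> coor B p j != 0 ->
  replace_row B j p \in unitmx.
Proof.
move=> uB pj; rewrite -row_free_unit; apply: inj_row_free => a.
rewrite mulmx_sum_row => E.
have h k : a ord0 j * coor B p k + (if k == j then 0 else a ord0 k) = 0.
  by rewrite -coor_replace_comb// E /coor dot0l.
have aj : a ord0 j = 0.
  by have := h j; rewrite eqxx addr0 => /eqP; rewrite mulf_eq0 (negPf pj) orbF => /eqP.
apply/rowP => k; rewrite [RHS]mxE; have := h k; rewrite aj mul0r add0r.
by case: eqP => [->|].
Qed.

Lemma coor_replace_row B j p q i : B \in unitmx -> coor B p j != 0 ->
  coor (replace_row B j p) q i =
  if i == j then coor B q j / coor B p j
  else coor B q i - coor B p i * (coor B q j / coor B p j).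
Proof.
move=> uB pj; pose a i := if i == j then coor B q j / coor B p j
  else coor B q i - coor B p i * (coor B q j / coor B p j).
rewrite -[RHS]/(a i); apply: coor_uniq; first exact: replace_row_unit.
apply: (coor_inj uB) => k; rewrite coor_replace_comb// /a eqxx.
by case: eqP => [->|_]; [rewrite addr0 mulfVK|rewrite mulrC addrC subrK].
Qed.

Lemma inside_replace_row B j p q : B \in unitmx -> coor B p j != 0 ->
  inside (replace_row B j p) q = (0 < coor B q j / coor B p j) &&
   [forall i, (i != j) ==> (coor B p i * (coor B q j / coor B p j) < coor B q i)].
Proof.
move=> uB pj; apply/forallP/andP => [h|[h1 /forallP h2] i].
  split; first by have := h j; rewrite coor_replace_row// eqxx.
  apply/forallP => i; apply/implyP => ij; have := h i.
  by rewrite coor_replace_row// (negPf ij) subr_gt0.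
rewrite coor_replace_row//; case: eqVneq => // ij; rewrite subr_gt0.
exact: (implyP (h2 i)).
Qed.

(** Coning the boundary of a simplicial cone, with signs, from a vector p
    outside the opposite cone gives back the cone. Vanishing coordinates of
    p are allowed, so that this covers both the generic coning and the
    subdivision of a simplex at a point of an edge. *)
Lemma stellar B p : B \in unitmx -> (exists j, 0 < coor B p j) ->
  \forall q \near generic, (inside B q)%:R = \sum_(j | coor B p j != 0)
    Num.sg (coor B p j) * (inside (replace_row B j p) q)%:R :> R.
Proof.
move=> uB pj; have h1 := coor_neq0_generic uB.
have h2 : \forall q \near generic, forall i j, i != j -> coor B p j != 0 ->
    coor B q i * coor B p j != coor B q j * coor B p i.
  apply: filter_forall => i; apply: filter_forall => j.
  have [->|ij] := eqVneq i j; first by apply: nearW => q.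
  have [->|lj] := eqVneq (coor B p j) 0; first by apply: nearW => q.
  have : coor B p j *: cform B i + (- coor B p i) *: cform B j != 0.
    by apply: cform_comb_neq0 => //; rewrite lj.
  move=> /(off_planes_form id); apply: filterS => q /= + _ _.
  rewrite dotDr !dotZr mulNr subr_eq0 mulrC.
  by rewrite [X in _ != X]mulrC.
apply: filterS2 h1 h2 => q h1 h2.
rewrite [LHS](stellar_count h1 h2 pj).
by apply: eq_bigr => j lj; rewrite inside_replace_row.
Qed.

End stellar.

(** * Integral combinations of simplices; Caratheodory's theorem *)

Section simplex_span.
Context {R : realType} {d : nat}.
Implicit Types (v : 'I_d.+1 -> 'rV[R]_d) (g : 'rV[R]_d -> R).

Definition simplex_span g : Prop :=
  exists2 s : seq (int * ('I_d.+1 -> 'rV[R]_d)),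
    all (fun k => vertex_mx k.2 \in unitmx) s &
    \forall x \near affine_generic,
      g x = \sum_(k <- s) k.1%:~R * (inside (vertex_mx k.2) (hat x))%:R.

Lemma simplex_span_ext g h :
  (\forall x \near affine_generic, g x = h x) -> simplex_span g -> simplex_span h.
Proof.
move=> gh [s us hs]; exists s => //.
by apply: filterS2 gh hs => x <-.
Qed.

Lemma simplex_span_eq g h : g =1 h -> simplex_span g -> simplex_span h.
Proof. by move=> gh; apply: simplex_span_ext; exact: nearW. Qed.

Lemma simplex_span0 : simplex_span (fun=> 0).
Proof. by exists [::] => //; apply: nearW => x; rewrite big_nil. Qed.

Lemma simplex_spanD g h : simplex_span g -> simplex_span h -> simplex_span (fun x => g x + h x).
Proof.
move=> [s us hs] [t ut ht]; exists (s ++ t); first by rewrite all_cat us.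
by apply: filterS2 hs ht => x -> ->; rewrite big_cat.
Qed.

Lemma simplex_spanZ (a : int) g : simplex_span g -> simplex_span (fun x => a%:~R * g x).
Proof.
move=> [s us hs]; exists [seq (a * k.1, k.2) | k <- s].
  by rewrite all_map.
apply: filterS hs => x ->; rewrite big_map mulr_sumr; apply: eq_bigr => k _.
by rewrite intrM mulrA.
Qed.

Lemma simplex_spanB g h : simplex_span g -> simplex_span h -> simplex_span (fun x => g x - h x).
Proof.
move=> sg /(simplex_spanZ (-1)) sh; apply: simplex_span_eq (simplex_spanD sg sh) => x.
by rewrite mulN1r.
Qed.

Lemma simplex_span_sum (I : Type) (r : seq I) (P : pred I) (g : I -> 'rV[R]_d -> R) :
  (forall i, P i -> simplex_span (g i)) -> simplex_span (fun x => \sum_(i <- r | P i) g i x).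
Proof.
move=> sg; elim: r => [|i r IH].
  by apply: simplex_span_eq simplex_span0 => x; rewrite big_nil.
have [Pi|/negPf Pi] := boolP (P i).
  apply: simplex_span_eq (simplex_spanD (sg i Pi) IH) => x.
  by rewrite big_cons Pi.
by apply: simplex_span_eq IH => x; rewrite big_cons Pi.
Qed.

Lemma simplex_span_inside v : vertex_mx v \in unitmx ->
  simplex_span (fun x => (inside (vertex_mx v) (hat x))%:R).
Proof.
move=> uv; exists [:: (1, v)]; first by rewrite /= uv.
by apply: nearW => x; rewrite big_seq1 mul1r.
Qed.

Definition replace_vertex v j x : 'I_d.+1 -> 'rV[R]_d := fun i => if i == j then x else v i.

Lemma vertex_mx_replace_vertex v j x : vertex_mx (replace_vertex v j x) = replace_row (vertex_mx v) j (hat x).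
Proof.
apply/row_matrixP => i; rewrite row_vertex_mx row_replace_row row_vertex_mx /replace_vertex.
by case: eqP.
Qed.

Lemma dot_comb_vertex_mx v q (l : 'rV[R]_d.+1) : vertex_mx v \in unitmx ->
  dot q l = \sum_j coor (vertex_mx v) q j * dot (hat (v j)) l.
Proof.
move=> uv; rewrite {1}(coor_sum q uv) dot_suml; apply: eq_bigr => j _.
by rewrite dotZl row_vertex_mx.
Qed.

(** If a form changes sign on the vertices, subdivide the simplex at the point
    m where the form vanishes on an edge: both pieces have one vertex fewer
    off the hyperplane. *)
Lemma simplex_span_cut v (l : 'rV[R]_d.+1) : vertex_mx v \in unitmx ->
  simplex_span (fun x => (inside (vertex_mx v) (hat x))%:R * (0 < dot (hat x) l)%R%:R).
Proof.
have [N] := ubnP #|[pred j | dot (hat (v j)) l != 0]|.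
elim: N => // N IH in v *; rewrite ltnS => leN uv.
have [->|l0] := eqVneq l 0.
  by apply: simplex_span_eq simplex_span0 => x; rewrite dot0r ltxx mulr0.
have [/forallP hpos|] := boolP [forall j, 0 <= dot (hat (v j)) l].
  apply: simplex_span_ext (simplex_span_inside uv).
  apply: filterS (off_planes_form hat l0) => x xl.
  have [/forallP hx|] := boolP (inside (vertex_mx v) (hat x)); last by rewrite mul0r.
  suff -> : 0 < dot (hat x) l by rewrite mulr1.
  rewrite lt_neqAle eq_sym xl (dot_comb_vertex_mx (hat x) l uv) sumr_ge0// => j _.
  by apply: mulr_ge0 => //; exact: ltW (hx j).
rewrite negb_forall => /existsP[b]; rewrite -ltNge => hb.
have [/forallP hneg|] := boolP [forall j, dot (hat (v j)) l <= 0].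
  apply: simplex_span_eq simplex_span0 => x.
  have [/forallP hx|] := boolP (inside (vertex_mx v) (hat x)); last by rewrite mul0r.
  rewrite ltNge (_ : _ <= 0) ?mulr0// (dot_comb_vertex_mx (hat x) l uv).
  by rewrite -oppr_ge0 -sumrN sumr_ge0// => j _; rewrite -mulrN mulr_ge0 ?oppr_ge0//; exact: ltW (hx j).
rewrite negb_forall => /existsP[a]; rewrite -ltNge => ha.
have ab : a != b by apply: contraTneq ha => ->; rewrite -leNgt ltW.
set la := dot (hat (v a)) l in ha *; set lb := dot (hat (v b)) l in hb *.
have D0 : 0 < la - lb by rewrite subr_gt0 (lt_trans hb).
(* m is the zero of l on the edge from v a to v b. *)
pose e := la / (la - lb); pose m := (1 - e) *: v a + e *: v b.
have e0 : 0 < e by rewrite divr_gt0.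
have e1 : 0 < 1 - e.
  by rewrite subr_gt0 ltr_pdivrMr// mul1r; lra.
have hm : hat m = (1 - e) *: hat (v a) + e *: hat (v b) by rewrite hat_segment.
have ml : dot (hat m) l = 0.
  rewrite hm dotDl !dotZl -/la -/lb /e; field; lra.
have cm j : coor (vertex_mx v) (hat m) j = (1 - e) * (a == j)%:R + e * (b == j)%:R.
  by rewrite hm coorD !coorZ !coor_vertex.
have cma : 0 < coor (vertex_mx v) (hat m) a.
  by rewrite cm eqxx (eq_sym b) (negPf ab) mulr0 addr0 mulr1.
have cj j : coor (vertex_mx v) (hat m) j != 0 ->
    0 < coor (vertex_mx v) (hat m) j /\ dot (hat (v j)) l != 0.
  rewrite cm; have [<-|aj] := eqVneq a j.
    by rewrite (eq_sym b) (negPf ab) mulr0 addr0 mulr1 => _; split; rewrite ?gt_eqF.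
  have [<-|bj] := eqVneq b j; last by rewrite !mulr0 addr0 eqxx.
  by rewrite mulr0 add0r mulr1 => _; split; rewrite ?lt_eqF.
have : simplex_span (fun x => \sum_(j | coor (vertex_mx v) (hat m) j != 0)
    (inside (vertex_mx (replace_vertex v j m)) (hat x))%:R * (0 < dot (hat x) l)%R%:R).
  apply: simplex_span_sum => j mj; have [_ vjl] := cj j mj; apply: IH; last first.
    by rewrite vertex_mx_replace_vertex replace_row_unit.
  apply: leq_trans leN; apply: proper_card; apply/properP; split.
    apply/fintype.subsetP => i; rewrite !inE /replace_vertex.
    by case: (i =P j) => // _; rewrite ml eqxx.
  by exists j; rewrite !inE//= /replace_vertex eqxx ml eqxx.
apply: simplex_span_ext; have := generic_hat (stellar uv (ex_intro _ a cma)).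
apply: filterS => x ->; rewrite mulr_suml; apply: eq_bigr => j /cj[cj0 _].
by rewrite vertex_mx_replace_vertex gtr0_sg// mul1r.
Qed.

Lemma simplex_span_halfspace g (l : 'rV[R]_d.+1) : simplex_span g ->
  simplex_span (fun x => g x * (0 < dot (hat x) l)%R%:R).
Proof.
move=> [s us hs]; have : simplex_span (fun x =>
    \sum_(k <- s) k.1%:~R * (inside (vertex_mx k.2) (hat x))%:R * (0 < dot (hat x) l)%R%:R).
  elim: s us {hs} => [_|k s IH /= /andP[uk us]].
    by apply: simplex_span_eq simplex_span0 => x; rewrite big_nil.
  apply: simplex_span_eq (simplex_spanD (simplex_spanZ k.1 (simplex_span_cut l uk)) (IH us)) => x.
  by rewrite big_cons mulrA.
by apply: simplex_span_ext; apply: filterS hs => x ->; rewrite mulr_suml.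
Qed.

Lemma simplex_span_mul_inside g v : simplex_span g -> vertex_mx v \in unitmx ->
  simplex_span (fun x => g x * (inside (vertex_mx v) (hat x))%:R).
Proof.
move=> sg uv; have H (r : seq 'I_d.+1) : simplex_span (fun x =>
    g x * \prod_(j <- r) (0 < coor (vertex_mx v) (hat x) j)%R%:R).
  elim: r => [|j r IH].
    by apply: simplex_span_eq sg => x; rewrite big_nil mulr1.
  apply: simplex_span_eq (simplex_span_halfspace (cform (vertex_mx v) j) IH) => x.
  by rewrite big_cons mulrAC -mulrA.
by apply: simplex_span_eq (H _) => x; rewrite /inside -prod_bool.
Qed.

(** Inclusion-exclusion for a union, the product with a simplex being a product
    of half-spaces. *)
Lemma simplex_span_exists (I : finType) (v : I -> 'I_d.+1 -> 'rV[R]_d) :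
  simplex_span (fun x => [exists i, (vertex_mx (v i) \in unitmx) &&
                               inside (vertex_mx (v i)) (hat x)]%:R).
Proof.
pose b x i := (vertex_mx (v i) \in unitmx) && inside (vertex_mx (v i)) (hat x).
have H (r : seq I) : simplex_span (fun x => (has (b x) r)%:R).
  elim: r => [|i r IH]; first exact: simplex_span0.
  have [uv|nuv] := boolP (vertex_mx (v i) \in unitmx); last first.
    by apply: simplex_span_eq IH => x; rewrite /= {2}/b (negPf nuv).
  have sv := simplex_span_inside uv.
  apply: simplex_span_eq (simplex_spanB (simplex_spanD sv IH) (simplex_span_mul_inside IH uv)) => x.
  rewrite /= {3}/b uv/=.
  by case: inside; case: has; rewrite /= ?mulr1 ?mulr0 ?addr0 ?subr0 ?add0r ?addrK.
apply: simplex_span_eq (H (enum I)) => x; congr (_%:R); congr nat_of_bool.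
by apply/hasP/existsP => [[i _ bi]|[i bi]]; exists i => //; rewrite mem_enum.
Qed.

End simplex_span.

Section caratheodory.
Context {R : realType} {n m : nat}.
Variable A : 'M[R]_(n, m).

(** Among the nonnegative combinations with the same value, one of minimal
    support involves only free rows: along a linear relation between its
    rows one could move until a coefficient vanishes. *)
Lemma caratheodory (a : 'rV[R]_n) : (forall i, 0 <= a ord0 i) ->
  exists b : 'rV[R]_n, [/\ forall i, 0 <= b ord0 i, b *m A = a *m A &
    forall k : 'rV[R]_n, (forall i, b ord0 i = 0 -> k ord0 i = 0) ->
      k *m A = 0 -> k = 0].
Proof.
have [N] := ubnP #|[pred i | a ord0 i != 0]|.
elim: N => // N IH in a *; rewrite ltnS => leN a0.
have [h|] := pselect (forall k : 'rV[R]_n,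
    (forall i, a ord0 i = 0 -> k ord0 i = 0) -> k *m A = 0 -> k = 0).
  by exists a.
move=> /existsNP[k0 /not_implyP[hk0 /not_implyP[k0A /eqP k00]]].
have [k [hk kA [i0 ki0]]] : exists k : 'rV[R]_n,
    [/\ forall i, a ord0 i = 0 -> k ord0 i = 0, k *m A = 0 &
      exists i, 0 < k ord0 i].
  have [i] := dot_neq0_ex k00; rewrite neq_lt => /orP[ki|ki].
    exists (- k0); split; first by move=> j /hk0; rewrite mxE => ->; rewrite oppr0.
      by rewrite mulNmx k0A oppr0.
    by exists i; rewrite mxE oppr_gt0.
  by exists k0; split => //; exists i.
have [j kj jmin] := @arg_minP _ R 'I_n i0 (fun i => 0 < k ord0 i)
  (fun i => a ord0 i / k ord0 i) ki0.
(* The largest step along k that keeps all the coefficients nonnegative. *)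
pose t := a ord0 j / k ord0 j.
have t0 : 0 <= t by rewrite divr_ge0// ltW.
have bE i : (a - t *: k) ord0 i = a ord0 i - t * k ord0 i by rewrite !mxE.
have aj : a ord0 j != 0.
  by apply: contraTneq kj => /hk ->; rewrite ltxx.
have [] := IH (a - t *: k).
- apply: leq_trans leN; apply: proper_card; apply/properP; split.
    apply/fintype.subsetP => i; rewrite !inE; apply: contra => /eqP ai.
    by rewrite bE ai (hk i ai) mulr0 subr0.
  by exists j; rewrite !inE// bE /t divfK ?subrr ?eqxx// gt_eqF.
- move=> i; rewrite bE subr_ge0; have [ki|ki] := ltP 0 (k ord0 i).
    by rewrite -ler_pdivlMr// jmin.
  by apply: le_trans (a0 i); rewrite mulr_ge0_le0.
- move=> b [b0 bA bk]; exists b; split => //.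
  by rewrite bA mulmxBl -scalemxAl kA scaler0 subr0.
Qed.

End caratheodory.

(** * Convex hulls of finitely many points *)

Section hull_points.
Context {R : realType} {d n : nat}.
Variable p : 'I_n -> 'rV[R]_d.

Definition points_mx : 'M[R]_(n, d.+1) := \matrix_i hat (p i).

Lemma comb_points_mx (a : 'rV[R]_n) : a *m points_mx = \sum_i a ord0 i *: hat (p i).
Proof. by rewrite mulmx_sum_row; apply: eq_bigr => i _; rewrite rowK. Qed.

Lemma hull_points_mxP x : hull p x <->
  exists2 a : 'rV[R]_n, (forall i, 0 <= a ord0 i) & a *m points_mx = hat x.
Proof.
split=> [[a [a0 a1 ->]]|[a a0 ax]].
  exists (\row_i a i) => [i|]; first by rewrite mxE.
  rewrite comb_points_mx; apply: rV_split_ext.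
    rewrite hat0E summxE -[RHS]a1; apply: eq_bigr => i _.
    by rewrite mxE mxE hat0E mulr1.
  rewrite tail_hat tail_sum; apply: eq_bigr => i _.
  by rewrite tailZ tail_hat mxE.
exists (a ord0); split => //.
  rewrite -[RHS](hat0E x) -ax comb_points_mx summxE; apply: eq_bigr => i _.
  by rewrite mxE hat0E mulr1.
rewrite -[LHS]tail_hat -ax comb_points_mx tail_sum; apply: eq_bigr => i _.
by rewrite tailZ tail_hat.
Qed.

(** Right multiplication by this matrix restricts a coefficient vector to S. *)
Definition row_selector (S : {set 'I_n}) : 'M[R]_n := diag_mx (\row_i (i \in S)%:R).

Lemma mul_row_selector (S : {set 'I_n}) (a : 'rV[R]_n) i :
  (a *m row_selector S) ord0 i = if i \in S then a ord0 i else 0.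
Proof.
by rewrite mul_mx_diag !mxE; case: ifP; rewrite ?mulr1 ?mulr0.
Qed.

Lemma row_selector_id (S : {set 'I_n}) (a : 'rV[R]_n) :
  (forall i, i \notin S -> a ord0 i = 0) -> a *m row_selector S = a.
Proof.
move=> h; apply/rowP => i; rewrite mul_row_selector; case: ifPn => // /h.
by move=> ->.
Qed.

Lemma hull_caratheodory x : hull p x -> exists (S : {set 'I_n}) (a : 'rV[R]_n),
  [/\ forall i, 0 <= a ord0 i, a *m points_mx = hat x, a *m row_selector S = a &
      forall k : 'rV[R]_n, k *m row_selector S *m points_mx = 0 -> k *m row_selector S = 0].
Proof.
move=> /hull_points_mxP[a0 a0p a0x].
have [a [ap ax ak]] := caratheodory points_mx a0p.
exists [set i | a ord0 i != 0]%SET, a; split=> //; first by rewrite ax.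
  by apply: row_selector_id => i; rewrite inE negbK => /eqP.
move=> k; apply: ak => i ai; rewrite mul_row_selector inE ai eqxx//.
Qed.

(** A left inverse of the map sending coefficient vectors supported on S to
    points, when the rows in S are free. *)
Definition facecoor (S : {set 'I_n}) : 'M[R]_(d.+1, n) :=
  pinvmx (row_selector S *m points_mx) *m row_selector S.

(** A description of the hull by finitely many linear conditions, which makes
    it measurable. *)
Lemma hull_faces x : hull p x <-> exists S : {set 'I_n},
  (forall i, 0 <= (hat x *m facecoor S) ord0 i) /\
  hat x *m facecoor S *m points_mx = hat x.
Proof.
split=> [/hull_caratheodory[S [a [a0 ax aS kS]]]|[S [h1 h2]]]; last first.
  by apply/hull_points_mxP; exists (hat x *m facecoor S).
suff E : hat x *m facecoor S = a by exists S; rewrite E.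
apply/esym/eqP; rewrite -subr_eq0; apply/eqP.
have xS : hat x *m facecoor S *m points_mx = hat x.
  rewrite /facecoor (mulmxA (hat x)) -(mulmxA _ (row_selector S) points_mx) mulmxKpV//.
  by rewrite -ax -{1}aS -mulmxA submxMl.
have rr : row_selector S *m row_selector S = row_selector S.
  apply/row_matrixP => i; rewrite row_mul; apply/rowP => j; rewrite mul_row_selector.
  by rewrite !mxE; case: ifP => // jS; case: eqP => // ->; rewrite jS.
have E : (a - hat x *m facecoor S) *m row_selector S = a - hat x *m facecoor S.
  by rewrite mulmxBl aS /facecoor (mulmxA (hat x)) -(mulmxA _ (row_selector S)) rr.
rewrite -E; apply: kS; rewrite E mulmxBl ax xS subrr//.
Qed.

Lemma sub_hull (f : 'I_d.+1 -> 'I_n) x : hull (p \o f) x -> hull p x.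
Proof.
move=> [a [a0 a1 ->]]; exists (fun i => \sum_(j | f j == i) a j); split.
- by move=> i; exact: sumr_ge0.
- by rewrite -a1 (partition_big f xpredT).
- rewrite (partition_big f xpredT)//=; apply: eq_bigr => i _.
  by rewrite scaler_suml; apply: eq_bigr => j /eqP <-.
Qed.

Lemma face_form (S : {set 'I_n}) : ~~ row_full (row_selector S *m points_mx) ->
  exists2 l : 'rV[R]_d.+1, l != 0 &
    forall a : 'rV[R]_n, dot (a *m (row_selector S *m points_mx)) l = 0.
Proof.
rewrite -col_leq_rank -subn_eq0 -mxrank_coker mxrank_eq0 => h.
have /existsP[i /existsP[j cij]] :
    [exists i, exists j, cokermx (row_selector S *m points_mx) i j != 0].
  apply: contraNT h => /existsPn h; apply/eqP/matrixP => i j.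
  by have /existsPn/(_ j) := h i; rewrite negbK => /eqP ->; rewrite mxE.
exists (col j (cokermx (row_selector S *m points_mx)))^T.
  by apply: contra_neq cij => /rowP/(_ i); rewrite !mxE.
by move=> a; rewrite dot_trmx_col -mulmxA mulmx_coker mulmx0 mxE.
Qed.

(** A generic point cannot lie in the hull of a non-spanning family, so a
    Caratheodory family through it is the vertex set of a full-dimensional
    simplex. *)
Lemma hull_generic : \forall x \near affine_generic, hull p x <->
  exists f : {ffun 'I_d.+1 -> 'I_n},
    vertex_mx (p \o f) \in unitmx /\ inside (vertex_mx (p \o f)) (hat x).
Proof.
have offS : \forall x \near (@affine_generic R d), forall S : {set 'I_n},
    forall a : 'rV[R]_n, a *m (row_selector S *m points_mx) = hat x ->
    row_full (row_selector S *m points_mx).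
  apply: filter_forall => S.
  have [Sfull|/face_form[l l0 hl]] := boolP (row_full (row_selector S *m points_mx)).
    exact: nearW.
  apply: filterS (off_planes_form hat l0) => x + a ax.
  by rewrite -ax hl eqxx.
have nz : \forall x \near (@affine_generic R d), forall f : {ffun 'I_d.+1 -> 'I_n},
    vertex_mx (p \o f) \in unitmx -> forall j, coor (vertex_mx (p \o f)) (hat x) j != 0.
  apply: filter_forall => f.
  have [uf|_] := boolP (vertex_mx (p \o f) \in unitmx); last exact: nearW.
  by apply: filterS (generic_hat (coor_neq0_generic uf)) => x.
apply: filterS2 offS nz => x offS nz; split; last first.
  move=> [f [uf /forallP xf]]; apply: (@sub_hull f); apply/hullP => // j.
  exact/ltW.
move=> /hull_caratheodory[S [a [a0 ax aS kS]]].
have Sfull : row_full (row_selector S *m points_mx) by apply: (offS S a); rewrite mulmxA aS.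
pose f : {ffun 'I_d.+1 -> 'I_n} := fullrankfun Sfull.
have uf0 : rowsub f (row_selector S *m points_mx) \in unitmx.
  by rewrite -row_full_unit; exact: fullrowsub_full.
have rowf j : row j (rowsub f (row_selector S *m points_mx)) =
    if f j \in S then hat (p (f j)) else 0.
  apply/rowP => k; rewrite /row_selector mul_diag_mx !mxE.
  by case: ifP => _; rewrite ?mul1r ?mul0r ?mxE.
have fS j : f j \in S.
  apply: contraT => /negPf fjS; have := coor_row j j uf0.
  by rewrite rowf fjS /coor dot0l eqxx => /esym/eqP; rewrite oner_eq0.
have E : rowsub f (row_selector S *m points_mx) = vertex_mx (p \o f).
  by apply/row_matrixP => j; rewrite rowf fS row_vertex_mx.
have uf : vertex_mx (p \o f) \in unitmx by rewrite -E.
exists f; split => //; apply/forallP => j; rewrite lt_neqAle eq_sym nz//=.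
pose c := coor (vertex_mx (p \o f)) (hat x).
pose b : 'rV[R]_n := \row_i \sum_(j | f j == i) c j.
have bS : b *m row_selector S = b.
  apply: row_selector_id => i iS; rewrite mxE big1// => k /eqP fk.
  by rewrite -fk fS in iS.
have bx : b *m points_mx = hat x.
  rewrite comb_points_mx [RHS](coor_sum _ uf) (partition_big f xpredT)//=.
  apply: eq_bigr => i _; rewrite mxE scaler_suml; apply: eq_bigr => k /eqP <-.
  by rewrite row_vertex_mx.
have ba : b = a.
  apply/eqP; rewrite -subr_eq0; apply/eqP; have := kS (b - a).
  by rewrite mulmxBl bS aS; apply; rewrite mulmxBl bx ax subrr.
have := a0 (f j); rewrite -ba mxE (big_pred1 j)// => k /=.
by apply/eqP/eqP => [/fullrankfun_inj|->].
Qed.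

End hull_points.

(** * Cancellation of the facets coplanar with the origin *)

Lemma dnbhs0_signs (R : realType) (Q : R -> Prop) : (\forall e \near 0^', Q e) ->
  (exists2 e, 0 < e & Q e) /\ (exists2 e, e < 0 & Q e).
Proof.
move=> hQ; have h : \forall e \near 0, e != 0 -> Q e by exact: hQ.
split.
  have /filter_ex[e [h1 e0]] : \forall e \near 0^'+, (e != 0 -> Q e) /\ 0 < e.
    near=> e; split; last by near: e; exact: nbhs_right_gt.
    by near: e; apply: cvg_within; exact: h.
  by exists e => //; apply: h1; rewrite gt_eqF.
have /filter_ex[e [h1 e0]] : \forall e \near 0^'-, (e != 0 -> Q e) /\ e < 0.
  near=> e; split; last by near: e; exact: nbhs_left_lt.
  by near: e; apply: cvg_within; exact: h.
by exists e => //; apply: h1; rewrite lt_eqF.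
Unshelve. all: by end_near. Qed.

Lemma sum_classes_eq0 (V : zmodType) (I : finType) (T : eqType) (h : I -> T)
    (P : pred I) (F : I -> V) :
  (forall t, \sum_(a | P a && (h a == t)) F a = 0) -> \sum_(a | P a) F a = 0.
Proof.
have [N] := ubnP #|P|; elim: N => // N IH in P *; rewrite ltnS => leN hF.
have [a0 Pa0|P0] := pickP P; last by rewrite big_pred0.
rewrite (bigID (fun a => h a == h a0))/= hF add0r; apply: IH.
  apply: leq_trans leN; apply: proper_card; apply/properP; split.
    by apply/fintype.subsetP => a /andP[].
  by exists a0 => //; apply/negP => /andP[_]; rewrite eqxx.
move=> t; have [->|th] := eqVneq t (h a0).
  by rewrite big_pred0// => a; rewrite -andbA andNb andbF.
rewrite -[RHS](hF t); apply: eq_bigl => a; rewrite -andbA; congr andb.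
by case: (h a =P t) => [->|]; rewrite ?andbF ?andbT ?th.
Qed.

Section jump.
Context {R : realType} {d : nat} {I : finType}.
Variables (m : I -> R) (v : I -> 'I_d.+1 -> 'rV[R]_d) (P : set 'rV[R]_d).
Hypothesis uv : forall i, vertex_mx (v i) \in unitmx.
Hypothesis hP : \forall x \near affine_generic,
  (x \in P)%:R = \sum_i m i * (inside (vertex_mx (v i)) (hat x))%:R.
Hypothesis ncP : ~ codegenerate P.
Variable p : 'rV[R]_d.

Notation lam i j := (coor (vertex_mx (v i)) (hat p) j).
Notation C i j := (cform (vertex_mx (v i)) j).
Notation N i j := ((lam i j)^-1 *: C i j).

Hypothesis lam0 : forall i j, lam i j != 0.

Lemma cformE i j (M : 'rV[R]_d.+1) : N i j = M -> C i j = lam i j *: M.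
Proof. by move=> <-; rewrite scalerA mulfV// scale1r. Qed.

Lemma N_inj i j k : N i j = N i k -> j = k.
Proof.
move=> E; apply: contraTeq isT => jk.
have : (lam i j)^-1 *: C i j + (- (lam i k)^-1) *: C i k != 0.
  by apply: cform_comb_neq0 => //; rewrite invr_eq0 lam0.
by rewrite scaleNr E subrr eqxx.
Qed.

(** The i-th simplex seen from the side b of the hyperplane M = 0 at a generic
    point Z of that hyperplane. Forms are normalized by their value 1 at p,
    so two facets span the same hyperplane exactly when their normalized
    forms agree. *)
Definition side M Z i (b : bool) : bool := [forall k,
  if N i k == M then (if b then 0 < lam i k else lam i k < 0)
  else 0 < coor (vertex_mx (v i)) Z k].

(** A simplex has at most one facet in a given hyperplane, and its indicator
    jumps across that hyperplane exactly at the points of this facet. *)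
Lemma side_jump M Z i :
  \sum_(j | N i j == M) Num.sg (lam i j) *
    [forall k, (k != j) ==> (0 < coor (vertex_mx (v i)) Z k)]%:R
  = (side M Z i true)%:R - (side M Z i false)%:R :> R.
Proof.
have [/existsP[j /eqP jM]|] := boolP [exists j, N i j == M]; last first.
  rewrite negb_exists => /forallP none; rewrite big_pred0; last first.
    by move=> j; exact/negbTE.
  rewrite (_ : side M Z i true = side M Z i false) ?subrr//.
  by apply: eq_forallb => k; rewrite (negPf (none k)).
have kM k : (N i k == M) = (k == j).
  apply/eqP/eqP => [kM|->//]; apply: (@N_inj i); by rewrite kM jM.
rewrite (eq_bigl _ _ kM) big_pred1_eq.
set X := [forall k, _]; have sE b : side M Z i b =
    (if b then 0 < lam i j else lam i j < 0) && X.
  apply/forallP/andP => [h|[hb /forallP h] k]; last first.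
    by rewrite kM; case: eqP => [->//|/eqP kj]; exact: (implyP (h k)).
  split; first by have := h j; rewrite kM eqxx.
  apply/forallP => k; apply/implyP => kj.
  by have := h k; rewrite kM (negPf kj).
rewrite !sE; have := lam0 i j; case: ltrgt0P => // h _.
  by rewrite gtr0_sg// mul1r/= subr0.
by rewrite ltr0_sg// mulN1r/= sub0r.
Qed.

Lemma side_neg M Z i b : dot Z M = 0 -> Z ord0 ord0 < 0 -> side M Z i b = false.
Proof.
move=> ZM; rewrite -(sum_coor Z (uv i)) => Z0; apply: contraTF Z0 => /forallP h.
rewrite -leNgt sumr_ge0// => k _; have := h k; case: eqP => [kM _|_ /ltW//].
by rewrite /coor (cformE kM) dotZr ZM mulr0.
Qed.

(** Near Z, generic points on either side of M = 0 take the two values G true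
    and G false. If these differ, one of them belongs to P and the other
    does not, on every neighbourhood of every point of the hyperplane near
    Z: so M = 0 is spanned by a facet of P and passes through the origin.
    When Z has negative first coordinate it lies outside all the cones. *)
Lemma side_eq M Z : dot (hat p) M = 1 -> dot (hat 0) M = 0 -> dot Z M = 0 ->
  Z ord0 ord0 != 0 ->
  (forall i k, N i k != M -> dot Z (C i k) != 0) ->
  \sum_i m i * (side M Z i true)%:R = \sum_i m i * (side M Z i false)%:R.
Proof.
move=> pM M0 ZM Z0 hZ; have [Zpos|Zneg|/eqP] := ltrgt0P (Z ord0 ord0); last first.
- by rewrite (negPf Z0).
- by rewrite !big1// => i _; rewrite side_neg// mulr0.
set G := fun b => \sum_i m i * (side M Z i b)%:R.
rewrite -/(G true) -/(G false); apply: contra_notP ncP => /eqP GG.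
have dM x : dot (hat x) M = dot x (tail M).
  by move: M0; rewrite !dot_hat dot0l addr0 => ->; rewrite add0r.
pose z := (Z ord0 ord0)^-1 *: tail Z.
have hz : hat z = (Z ord0 ord0)^-1 *: Z by exact: hat_homog.
exists (tail M); split.
  by apply/eqP => M00; move: pM; rewrite dM M00 dot0r => /esym/eqP; rewrite oner_eq0.
exists z; first by rewrite /hyperplane/= -dM hz dotZl ZM mulr0.
pose W y := forall i k, N i k != M ->
  (0 < coor (vertex_mx (v i)) (hat y) k) = (0 < coor (vertex_mx (v i)) Z k).
have Wz : \forall y \near z, W y.
  apply: near_forall => i; apply: near_forall => k.
  have [_|kM] := eqVneq (N i k) M; first exact: near_always.
  have := hZ i k kM; have zE : dot (hat z) (C i k) = (Z ord0 ord0)^-1 * dot Z (C i k).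
    by rewrite hz dotZl.
  rewrite /coor; case: ltrgt0P => // c0 _.
    apply: near_imply (@dot_hat_gt0_near _ _ (C i k) z _); last first.
      by rewrite zE mulr_gt0// invr_gt0.
    by move=> y -> _.
  apply: near_imply (@dot_hat_lt0_near _ _ (C i k) z _); last first.
    by rewrite zE pmulr_rlt0// invr_gt0.
  by move=> y yc _; apply/negbTE; rewrite -leNgt ltW.
move/nbhs_interior: Wz; apply: near_imply => y Wy yM.
have key (V : set 'rV[R]_d) : nbhs y V ->
    exists y1 y2, [/\ V y1, V y2, (y1 \in P)%:R = G true & (y2 \in P)%:R = G false].
  move=> yV; have M00 : M != 0.
    by apply: contra_eq_neq pM => ->; rewrite dot0r eq_sym oner_eq0.
  have : \forall r \near affine_generic, dot (hat r) M != 0 /\ \forall e \near (0:R)^',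
     ((1 - e) *: y + e *: r \in P)%:R =
     \sum_i m i * (inside (vertex_mx (v i)) (hat ((1 - e) *: y + e *: r)))%:R.
    apply: filterI; first exact: (off_planes_form hat M00).
    exact: (affine_generic_segment y hP).
  move=> /filter_ex[r [rM hr]].
  have {}hr : \forall e \near (0:R)^', [/\ ((1 - e) *: y + e *: r \in P)%:R =
     \sum_i m i * (inside (vertex_mx (v i)) (hat ((1 - e) *: y + e *: r)))%:R,
     V ((1 - e) *: y + e *: r) & W ((1 - e) *: y + e *: r)].
    near=> e; split; near: e => //.
      by apply: nbhs_dnbhs; exact: segment_near.
    by apply: nbhs_dnbhs; exact: segment_near.
  have val e : e != 0 -> W ((1 - e) *: y + e *: r) ->
      \sum_i m i * (inside (vertex_mx (v i)) (hat ((1 - e) *: y + e *: r)))%:R =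
      G (0 < e * dot (hat r) M).
    move=> e0 We; apply: eq_bigr => i _; congr (_ * _%:R); congr nat_of_bool.
    apply: eq_forallb => k; case: eqP => [kM|/eqP/We//].
    rewrite /coor (cformE kM) dotZr hat_segment dotDl !dotZl [dot (hat y) M]dM yM.
    rewrite mulr0 add0r -(cformE kM) -[dot (hat p) _]/(lam i k).
    have : e * dot (hat r) M != 0 by rewrite mulf_neq0.
    have := lam0 i k.
    case: (ltrgt0P (e * _)) => // he _ _; first by rewrite pmulr_lgt0.
    by rewrite nmulr_lgt0.
  have [[e1 e10 [P1 V1 W1]] [e2 e20 [P2 V2 W2]]] := dnbhs0_signs hr.
  have v1 := val e1 (negbT (gt_eqF e10)) W1.
  have v2 := val e2 (negbT (lt_eqF e20)) W2.
  have [rpos|rneg|/eqP] := ltrgt0P (dot (hat r) M); last by rewrite (negPf rM).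
    exists ((1 - e1) *: y + e1 *: r), ((1 - e2) *: y + e2 *: r); split=> //.
      by rewrite P1 v1 mulr_gt0.
    by rewrite P2 v2 ltNge (ltW _)// pmulr_llt0.
  exists ((1 - e2) *: y + e2 *: r), ((1 - e1) *: y + e1 *: r); split=> //.
    by rewrite P2 v2 nmulr_lgt0 ?e20.
  by rewrite P1 v1 ltNge (ltW _)// nmulr_llt0.
have PP y1 y2 : (y1 \in P)%:R = G true -> (y2 \in P)%:R = G false ->
    (y1 \in P) != (y2 \in P).
  by move=> E1 E2; apply: contra_neq GG => E; rewrite -E1 -E2 E.
split.
  move=> V /key[y1 [y2 [V1 V2 E1 E2]]]; have := PP _ _ E1 E2.
  have [y1P _|y1P] := boolP (y1 \in P); first by exists y1; split => //; exact: set_mem.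
  case: (boolP (y2 \in P)) => // y2P _.
  by exists y2; split => //; exact: set_mem.
move=> /key[y1 [y2 [V1 V2 E1 E2]]]; have := PP _ _ E1 E2.
by rewrite !mem_set.
Unshelve. all: by end_near. Qed.

(** The ray from p through x meets the hyperplane of a facet F at the point Z,
    and x lies in the cone over F with apex p when Z lies in F beyond x. So
    the terms with facets in one hyperplane add up to the jump at one and
    the same Z. *)
Lemma bad_facets_cancel : \forall x \near affine_generic,
  \sum_(a : I * 'I_d.+1 | coor (vertex_mx (v a.1)) (hat 0) a.2 == 0)
    m a.1 * (Num.sg (lam a.1 a.2) *
             (inside (replace_row (vertex_mx (v a.1)) a.2 (hat p)) (hat x))%:R) = 0.
Proof.
have gen1 : \forall x \near (@affine_generic R d), forall (a : I * 'I_d.+1) (i : I) (k : 'I_d.+1),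
    N i k != N a.1 a.2 ->
    dot (hat x) (C i k - lam i k *: N a.1 a.2) != 0.
  apply: filter_forall => a; apply: filter_forall => i; apply: filter_forall => k.
  have [_|kM] := eqVneq (N i k) (N a.1 a.2); first exact: nearW.
  have : C i k - lam i k *: N a.1 a.2 != 0.
    apply: contra_neq kM => /eqP; rewrite subr_eq0 => /eqP ->.
    by rewrite scalerA mulVf// scale1r.
  by move=> /(off_planes_form hat); apply: filterS => x xc _.
have gen2 : \forall x \near (@affine_generic R d), forall (a : I * 'I_d.+1),
    coor (vertex_mx (v a.1)) (hat 0) a.2 == 0 ->
    dot (hat x) (hat 0 - N a.1 a.2) != 0.
  apply: filter_forall => a.
  have [h0|_] := eqVneq (coor (vertex_mx (v a.1)) (hat 0) a.2) 0; last exact: nearW.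
  have : hat 0 - N a.1 a.2 != 0.
    apply/eqP => E; have := congr1 (dot (hat 0)) E.
    rewrite dot0r dotBr dotZr -[dot _ (C _ _)]/(coor _ _ _) h0 mulr0 subr0.
    by rewrite dot_hat dot0l hat0E addr0 => /eqP; rewrite oner_eq0.
  by move=> /(off_planes_form hat); apply: filterS => x xc _.
apply: filterS2 gen1 gen2 => x gen1 gen2.
apply: (@sum_classes_eq0 _ _ _ (fun a => N a.1 a.2)) => M.
have [a0 /andP[/eqP a00 /eqP a0M]|none] := pickP (fun a : I * 'I_d.+1 =>
  (coor (vertex_mx (v a.1)) (hat 0) a.2 == 0) && (N a.1 a.2 == M)); last by rewrite big_pred0.
have pM : dot (hat p) M = 1 by rewrite -a0M dotZr mulVf.
have M0 : dot (hat 0) M = 0.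
  by rewrite -a0M dotZr -[dot _ (C _ _)]/(coor _ _ _) a00 mulr0.
(* Z is the intersection of the line through x and p with M = 0, in
   homogeneous coordinates. *)
pose rho := dot (hat x) M; pose Z := hat x - rho *: hat p.
have ZM : dot Z M = 0 by rewrite dotBl dotZl pM mulr1 subrr.
have Z0 : Z ord0 ord0 != 0.
  have := gen2 a0; rewrite a00 eqxx => /(_ isT); rewrite a0M dotBr.
  rewrite [dot _ (hat 0)]dot_hat tail_hat dot0r hat0E addr0 -/rho.
  by have -> : Z ord0 ord0 = 1 - rho by rewrite /Z !mxE unlift_none/= mulr1.
have ZC i k : coor (vertex_mx (v i)) Z k = coor (vertex_mx (v i)) (hat x) k - lam i k * rho.
  by rewrite coorB coorZ mulrC.
have hZ i k : N i k != M -> dot Z (C i k) != 0.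
  rewrite -{1}a0M => /gen1; rewrite dotBr dotZr a0M -/rho.
  by rewrite -[X in _ -> X != 0]/(coor _ _ _) ZC.
have bad i j : N i j = M -> coor (vertex_mx (v i)) (hat 0) j = 0.
  by move=> E; rewrite /coor (cformE E) dotZr M0 mulr0.
have insE i j : N i j = M ->
    inside (replace_row (vertex_mx (v i)) j (hat p)) (hat x) = (0 < rho) &&
    [forall k, (k != j) ==> (0 < coor (vertex_mx (v i)) Z k)].
  move=> E; rewrite inside_replace_row//.
  have -> : coor (vertex_mx (v i)) (hat x) j / lam i j = rho.
    by rewrite [X in X / _]/coor (cformE E) dotZr mulrAC mulfV// mul1r.
  congr andb; apply: eq_forallb => k; congr implb.
  by rewrite ZC subr_gt0.
transitivity (\sum_(a : I * 'I_d.+1 | N a.1 a.2 == M) (0 < rho)%R%:R *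
   (m a.1 * (Num.sg (lam a.1 a.2) *
     [forall k, (k != a.2) ==> (0 < coor (vertex_mx (v a.1)) Z k)]%:R))).
  apply: eq_big => [a|a /andP[_ /eqP aM]].
    by case: (N a.1 a.2 =P M) => [/bad ->|_]; rewrite ?eqxx ?andbF.
  rewrite insE//; case: (0 < rho) => /=; first by rewrite mul1r.
  by rewrite mul0r !mulr0.
rewrite -mulr_sumr -(pair_big_dep xpredT (fun i j => N i j == M) (fun i j =>
  m i * (Num.sg (lam i j) *
     [forall k, (k != j) ==> (0 < coor (vertex_mx (v i)) Z k)]%:R)))/=.
rewrite (eq_bigr (fun i => m i * (side M Z i true)%:R - m i * (side M Z i false)%:R)).
  by rewrite sumrB (side_eq pM M0 ZM Z0 hZ) subrr mulr0.
by move=> i _; rewrite -mulrBr -side_jump mulr_sumr.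
Qed.

End jump.

(** * Non-codegenerate simplices generate *)

Section generation.
Context {R : realType} {d : nat}.
Implicit Types (v : 'I_d.+1 -> 'rV[R]_d) (P : set 'rV[R]_d).

Lemma polytope_simplex_span P : polytope P -> simplex_span (fun x : 'rV[R]_d => (x \in P)%:R).
Proof.
move=> [n [Q [cQ ->]]].
have /choice[S hS] i : exists kp : {k & 'I_k -> 'rV[R]_d}, Q i = hull (projT2 kp).
  by have [[k [p Qp]] _] := cQ i; exists (existT _ k p).
pose v (a : {i : 'I_n & {ffun 'I_d.+1 -> 'I_(projT1 (S i))}}) :=
  projT2 (S (tag a)) \o tagged a.
apply: simplex_span_ext (simplex_span_exists v).
have : \forall x \near affine_generic, forall i, Q i x <->
  exists f : {ffun 'I_d.+1 -> 'I_(projT1 (S i))},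
    vertex_mx (projT2 (S i) \o f) \in unitmx /\ inside (vertex_mx (projT2 (S i) \o f)) (hat x).
  by apply: filter_forall => i; rewrite hS; exact: hull_generic.
apply: filterS => x hx; congr (_%:R); congr nat_of_bool.
apply/existsP/idP => [[[i f] /andP[uf xf]]|]; rewrite inE.
  by exists i => //; apply/hx; exists f.
by move=> [i _ /hx[f [uf xf]]]; exists (existT _ i f); rewrite /v/= uf.
Qed.

(** Independence of the vertices and position of the origin off the facet
    hyperplanes: the algebraic form of non-codegeneracy. *)
Definition off_facets v : bool :=
  (vertex_mx v \in unitmx) && [forall j, coor (vertex_mx v) (hat 0) j != 0].

(** The cone with apex p over a facet F has, besides F, only facets through p;
    these avoid the origin for generic p as soon as F is not coplanar with
    the origin. *)
Lemma noncodegenerate_span P : ~ codegenerate P -> simplex_span (fun x : 'rV[R]_d => (x \in P)%:R) ->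
  exists2 s : seq (int * ('I_d.+1 -> 'rV[R]_d)),
    all (fun k => off_facets k.2) s &
    \forall x \near affine_generic,
      (x \in P)%:R = \sum_(k <- s) k.1%:~R * (inside (vertex_mx k.2) (hat x))%:R :> R.
Proof.
move=> ncP [s0 us0 hs0].
pose I := 'I_(size s0); pose m (i : I) := (tnth (in_tuple s0) i).1.
pose v (i : I) := (tnth (in_tuple s0) i).2.
have uv i : vertex_mx (v i) \in unitmx.
  by move/all_tnthP : (us0 : all _ (in_tuple s0)); exact.
have hP : \forall x \near affine_generic,
    (x \in P)%:R = \sum_i (m i)%:~R * (inside (vertex_mx (v i)) (hat x))%:R :> R.
  apply: filterS hs0 => x ->.
  by rewrite (big_tnth _ _ s0).
have gen1 : \forall p \near (@affine_generic R d), forall i j, coor (vertex_mx (v i)) (hat p) j != 0.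
  by apply: filter_forall => i; exact: generic_hat (coor_neq0_generic (uv i)).
have gen2 : \forall p \near (@affine_generic R d), forall i j k, k != j ->
    coor (vertex_mx (v i)) (hat 0) j != 0 ->
    dot (hat p) (coor (vertex_mx (v i)) (hat 0) k *: cform (vertex_mx (v i)) j +
                 - coor (vertex_mx (v i)) (hat 0) j *: cform (vertex_mx (v i)) k) != 0.
  apply: filter_forall => i; apply: filter_forall => j; apply: filter_forall => k.
  have [_|kj] := eqVneq k j; first exact: nearW.
  have [_|c0] := eqVneq (coor (vertex_mx (v i)) (hat 0) j) 0; first exact: nearW.
  have /(off_planes_form hat) : coor (vertex_mx (v i)) (hat 0) k *: cform (vertex_mx (v i)) j +
      - coor (vertex_mx (v i)) (hat 0) j *: cform (vertex_mx (v i)) k != 0.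
    by apply: cform_comb_neq0 => //; [rewrite eq_sym|rewrite oppr_eq0 c0 orbT].
  by apply: filterS => p hp _ _.
have [p [gp1 gp2]] := filter_ex (filterI gen1 gen2).
pose good (a : I * 'I_d.+1) := coor (vertex_mx (v a.1)) (hat 0) a.2 != 0.
exists [seq (m a.1 * sgz (coor (vertex_mx (v a.1)) (hat p) a.2), replace_vertex (v a.1) a.2 p)
  | a <- [seq a <- enum {: I * 'I_d.+1} | good a]].
  rewrite all_map; apply/allP => -[i j]; rewrite mem_filter /good/= => /andP[gj _].
  rewrite /off_facets vertex_mx_replace_vertex replace_row_unit ?gp1//=; apply/forallP => k.
  rewrite coor_replace_row ?gp1//; case: ifPn => [_|kj].
    by rewrite mulf_neq0// invr_eq0 gp1.
  have := gp2 i j k kj gj; rewrite dotDr !dotZr -![dot _ (cform _ _)]/(coor _ _ _).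
  apply: contra_neq => /eqP; rewrite subr_eq0 mulrA => /eqP ->.
  by rewrite mulfVK// mulNr mulrC subrr.
have st : \forall x \near affine_generic, forall i, (inside (vertex_mx (v i)) (hat x))%:R =
    \sum_j Num.sg (coor (vertex_mx (v i)) (hat p) j) *
      (inside (replace_row (vertex_mx (v i)) j (hat p)) (hat x))%:R :> R.
  apply: filter_forall => i.
  have pos : exists j, 0 < coor (vertex_mx (v i)) (hat p) j.
    apply/existsP; apply: contraT; rewrite negb_exists => /forallP neg.
    have := sum_coor (hat p) (uv i); rewrite hat0E => E.
    suff : (1 : R) <= 0 by rewrite ler10.
    by rewrite -E -oppr_ge0 -sumrN sumr_ge0// => j _; rewrite oppr_ge0 leNgt neg.
  have := generic_hat (stellar (uv i) pos); apply: filterS => x ->.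
  by apply: eq_bigl => j; rewrite gp1.
have bad := bad_facets_cancel uv hP ncP gp1.
apply: filterS3 hP st bad => x -> st bad.
rewrite big_map big_filter big_enum_cond/=.
transitivity (\sum_(a : I * 'I_d.+1) (m a.1)%:~R *
   (Num.sg (coor (vertex_mx (v a.1)) (hat p) a.2) *
      (inside (replace_row (vertex_mx (v a.1)) a.2 (hat p)) (hat x))%:R)).
  rewrite -(pair_bigA _ (fun i j => (m i)%:~R *
   (Num.sg (coor (vertex_mx (v i)) (hat p) j) *
      (inside (replace_row (vertex_mx (v i)) j (hat p)) (hat x))%:R)))/=.
  by apply: eq_bigr => i _; rewrite st mulr_sumr.
rewrite (bigID (fun a => ~~ good a))/= [X in X + _](_ : _ = 0) ?add0r; last first.
  by rewrite -[RHS]bad; apply: eq_bigl => a; rewrite /good negbK.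
apply: eq_big => [a|a _]; first by rewrite negbK.
by rewrite intrM -sgrEz vertex_mx_replace_vertex mulrA.
Qed.

End generation.

(** * Lebesgue measure of hyperplanes, boxes and hulls *)

Section measure.
Context {R : realType}.

Lemma measurable_dot_hat d (l : 'rV[R]_d.+1) :
  measurable_fun [set: 'rV[R]_d] (fun x => dot (hat x) l : measurableTypeR R).
Proof.
under eq_fun do rewrite dot_hat.
apply: measurable_funD; first exact: measurable_cst.
apply: measurable_sum => i; apply: measurable_funM; last exact: measurable_cst.
exact: measurable_coord.
Qed.

Lemma measurable_form_ge0 d (l : 'rV[R]_d.+1) :
  measurable [set x : 'rV[R]_d | 0 <= dot (hat x) l].
Proof.
rewrite -[X in measurable X]setTI.
have -> : [set x : 'rV[R]_d | 0 <= dot (hat x) l] =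
   (fun x => dot (hat x) l : measurableTypeR R) @^-1` `[0, +oo[.
  by apply/seteqP; split=> x /=; rewrite in_itv/= andbT.
exact: measurable_dot_hat.
Qed.

Lemma measurable_form_eq0 d (l : 'rV[R]_d.+1) :
  measurable [set x : 'rV[R]_d | dot (hat x) l = 0].
Proof.
rewrite -[X in measurable X]setTI.
have -> : [set x : 'rV[R]_d | dot (hat x) l = 0] =
   (fun x => dot (hat x) l : measurableTypeR R) @^-1` [set 0] by [].
exact: measurable_dot_hat.
Qed.

Lemma measurable_hull d n (p : 'I_n -> 'rV[R]_d) : measurable (hull p).
Proof.
have -> : hull p = \bigcup_(S in [set: {set 'I_n}])
    ((\bigcap_(i in [set: 'I_n])
       [set x | 0 <= dot (hat x) (col i (facecoor p S))^T]) `&`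
     (\bigcap_(i in [set: 'I_d.+1])
       [set x | dot (hat x) ((col i (facecoor p S *m points_mx p))^T - delta_mx 0 i) = 0])).
  apply/seteqP; split=> [x /hull_faces[S [h1 h2]]|x [S _ [h1 h2]]].
    exists S => //; split=> i _; first by rewrite /mkset dot_trmx_col.
    by rewrite /mkset dotBr dot_trmx_col dot_delta mulmxA h2 subrr.
  apply/hull_faces; exists S; split=> [i|].
    by rewrite -dot_trmx_col; exact: h1.
  apply/rowP => i; have /eqP := h2 i I.
  by rewrite dotBr dot_trmx_col dot_delta mulmxA subr_eq0 => /eqP.
apply: fin_bigcup_measurable; first exact: finite_finset.
move=> S _; apply: measurableI; apply: fin_bigcap_measurable => [|i _].
- exact: finite_finset.
- exact: measurable_form_ge0.
- exact: finite_finset.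
- exact: measurable_form_eq0.
Qed.

Lemma rV_cons0 d (t : R) (y : 'rV[R]_d) : rV_cons (t, y) ord0 ord0 = t.
Proof.
rewrite /rV_cons (_ : ord0 = lshift d (ord0 : 'I_1)); last exact: val_inj.
by rewrite (row_mxEl (const_mx t : 'rV_1) y) mxE.
Qed.

Lemma tail_rV_cons d (t : R) (y : 'rV[R]_d) : tail (rV_cons (t, y)) = y.
Proof.
apply/rowP => j; rewrite mxE /rV_cons (_ : lift ord0 j = rshift 1 j).
  by rewrite (row_mxEr (const_mx t : 'rV_1) y).
exact: val_inj.
Qed.

(** Fubini, by induction on the dimension: all slices are hyperplanes unless
    the form depends on the first coordinate only, in which case its zero
    set is empty or a product with a single point of the line. *)
Lemma null_form d (l : 'rV[R]_d.+1) : l != 0 ->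
  lebesgue_rV R d [set x | dot (hat x) l = 0] = 0%E.
Proof.
elim: d l => [|d IH] l l0.
  rewrite (_ : [set x | _] = set0) ?measure0//; apply/seteqP; split => // x /= xl.
  have /eqP := xl; rewrite dot_hat {1}/dot big_ord0 addr0 => /eqP l00.
  case/eqP: l0; apply/rowP => i; rewrite mxE -l00; congr (l _ _); exact: ord1.
rewrite /= /lebesgue_step /pushforward.
set E := _ @^-1` _.
pose l1 := l ord0 (lift ord0 ord0).
pose l2 : 'rV[R]_d := tail (tail l).
have EE : E = [set p | l ord0 ord0 + p.1 * l1 + dot p.2 l2 = 0].
  by apply/seteqP; split=> -[t y];
    rewrite /E/= dot_hat dot_split rV_cons0 tail_rV_cons mxE addrA.
have [l20|l20] := eqVneq l2 0; last first.
  rewrite /product_measure1 integral0_eq// => t _ /=.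
  (* The equation of the slice at first coordinate t. *)
  pose lt : 'rV[R]_d.+1 := hat l2 + (l ord0 ord0 + t * l1 - 1) *: delta_mx 0 ord0.
  have lt0 : lt ord0 ord0 = l ord0 ord0 + t * l1.
    by rewrite !mxE unlift_none/= mulr1 addrC subrK.
  have tlt : tail lt = l2.
    rewrite tailD tailZ tail_hat (_ : tail (delta_mx 0 ord0) = 0) ?scaler0 ?addr0//.
    by apply/rowP => j; rewrite !mxE.
  rewrite [X in _ X = _](_ : _ = [set y | dot (hat y) lt = 0]); last first.
    by apply/seteqP; split=> y; rewrite /xsection/= inE EE/= dot_hat lt0 tlt.
  apply: IH; apply: contra_neq l20 => E0; rewrite -tlt E0.
  by apply/rowP => j; rewrite !mxE.
have [l10|l10] := eqVneq l1 0.
  rewrite (_ : E = set0) ?measure0// EE; apply/seteqP; split=> // -[t y] /=.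
  rewrite l10 l20 mulr0 dot0r !addr0 => l00; case/eqP: l0.
  apply: rV_split_ext; rewrite ?l00 ?mxE//; apply: rV_split_ext.
    by rewrite !mxE -[LHS]/l1 l10.
  by rewrite -[LHS]/l2 l20; apply/rowP => j; rewrite !mxE.
rewrite (_ : E = [set - l ord0 ord0 / l1] `*` setT); last first.
  rewrite EE; apply/seteqP; split=> -[t y] /=; rewrite l20 dot0r addr0.
    by move=> /eqP; rewrite addrC addr_eq0 => /eqP <-; split => //; rewrite mulfK.
  by move=> [-> _]; rewrite mulfVK// subrr.
rewrite product_measure1E//.
by rewrite [X in (X * _)%E](_ : _ = 0%E) ?mul0e//; exact: lebesgue_measure_set1.
Qed.

Lemma affine_generic_null d (Q : 'rV[R]_d -> Prop) : (\forall x \near affine_generic, Q x) ->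
  exists N, [/\ measurable N, lebesgue_rV R d N = 0%E & forall x, ~ N x -> Q x].
Proof.
move=> [L L0 h].
suff [N [mN N0 hN]] : exists N, [/\ measurable N, lebesgue_rV R d N = 0%E &
    forall x, ~ N x -> avoids L (hat x)].
  by exists N; split => // x /hN/h.
elim: L L0 {h} => [_|l L IH].
  by exists set0; split => //; exact: measure0.
rewrite inE negb_or eq_sym => /andP[l0 /IH[N [mN N0 hN]]].
exists ([set x | dot (hat x) l = 0] `|` N); split.
- by apply: measurableU => //; exact: measurable_form_eq0.
- by rewrite measureU0//; [exact: null_form|exact: measurable_form_eq0].
- by move=> x /not_orP[xl /hN xN]; apply/andP; split => //; exact/eqP.
Qed.

Definition box d (a b : 'I_d -> R) : set 'rV[R]_d :=
  [set x | forall i, a i < x ord0 i < b i].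

Lemma box_measurable d (a b : 'I_d -> R) : measurable (box a b).
Proof.
rewrite (_ : box a b = \bigcap_(i in [set: 'I_d])
    ((fun x : 'rV[R]_d => x ord0 i : measurableTypeR R) @^-1` `]a i, b i[)).
  apply: fin_bigcap_measurable => [|i _]; first exact: finite_finset.
  by rewrite -[X in measurable X]setTI; exact: measurable_coord.
by apply/seteqP; split=> x h i; [move=> _|]; have := h i; rewrite /= in_itv/=; auto.
Qed.

Lemma box_measure d (a b : 'I_d -> R) : (forall i, a i < b i) ->
  lebesgue_rV R d (box a b) = (\prod_(i < d) (b i - a i))%:E.
Proof.
move=> ab; pose A (i : 'I_d) : set (measurableTypeR R) := [set` `]a i, b i[].
have -> : box a b = [set x | forall i, A i (x ord0 i)].
  by apply/seteqP; split=> x h i; have := h i; rewrite /A/= in_itv.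
rewrite lebesgue_rV_box; last by move=> i; exact: measurable_itv.
rewrite -prodEFin; apply: eq_bigr => i _.
by rewrite lebesgue_measure_itv/= lte_fin ab.
Qed.

Definition finite_measure_set d (A : set 'rV[R]_d) :=
  measurable A /\ (lebesgue_rV R d A < +oo)%E.

Lemma finite_measure_hull d n (p : 'I_n -> 'rV[R]_d) : finite_measure_set (hull p).
Proof.
split; first exact: measurable_hull.
pose M := 1 + \sum_i \sum_j `|p i ord0 j|.
have pM i j : `|p i ord0 j| < M.
  rewrite (@le_lt_trans _ _ (\sum_i \sum_j `|p i ord0 j|)) ?ltrDr//.
  rewrite (bigD1 i)//= (bigD1 j)//= -addrA lerDl addr_ge0//.
    by apply: sumr_ge0.
  by apply: sumr_ge0 => k _; apply: sumr_ge0.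
have M0 : 0 < M.
  rewrite ltr_wpDr//; by apply: sumr_ge0 => i _; apply: sumr_ge0.
apply: (@le_lt_trans _ _ (lebesgue_rV R d (box (fun=> - M) (fun=> M)))).
  apply: le_measure; rewrite ?inE; [exact: measurable_hull|exact: box_measurable|].
  move=> x [a [a0 a1 ->]] j; rewrite -ltr_norml summxE.
  apply: (@le_lt_trans _ _ (\sum_i a i * `|p i ord0 j|)).
    apply: le_trans (ler_norm_sum _ _ _) _; apply: ler_sum => i _.
    by rewrite mxE normrM ger0_norm.
  have [i0 ai0] : exists i, 0 < a i.
    apply/existsP; apply: contraT; rewrite negb_exists => /forallP neg.
    have : \sum_i a i <= 0 by apply: sumr_le0 => i _; rewrite leNgt neg.
    by rewrite a1 ler10.
  rewrite -[ltRHS]mul1r -a1 mulr_suml (bigD1 i0)//= [ltRHS](bigD1 i0)//=.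
  rewrite ltr_leD ?ltr_pM2l//; apply: ler_sum => i _.
  by rewrite ler_wpM2l// ltW.
by rewrite box_measure ?ltry// => i; rewrite gtrN.
Qed.

Lemma finite_measure_polytope d (P : set 'rV[R]_d) : polytope P -> finite_measure_set P.
Proof.
move=> [n [Q [cQ ->]]].
have tQ i : finite_measure_set (Q i).
  by have [[k [p ->]] _] := cQ i; exact: finite_measure_hull.
have -> : \bigcup_i Q i = \big[setU/set0]_(i <- enum 'I_n) Q i.
  by rewrite -bigcup_seq; apply: eq_bigcupl; split=> i _ //=; rewrite mem_enum.
elim/big_ind: _ => [|A B [mA fA] [mB fB]|i _] //.
  by split => //; rewrite measure0.
split; first exact: measurableU.
apply: le_lt_trans (measureU2 _ _ _) _ => //.
by rewrite lte_add_pinfty.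
Qed.

Section null_combination.
Variables (d : nat) (I : Type) (m : I -> R) (A : I -> set 'rV[R]_d).
Hypothesis tA : forall i, finite_measure_set (A i).
Variable B : set 'rV[R]_d.
Hypothesis mB : measurable B.
Let mu := lebesgue_rV R d.
Local Open Scope ereal_scope.

Let muAB i : mu (A i `&` B) < +oo.
Proof.
have [mA fA] := tA i; apply: le_lt_trans fA; apply: le_measure => //.
- by rewrite inE; exact: measurableI.
- by rewrite inE.
Qed.

Let int_indic i : mu.-integrable setT (EFin \o \1_(A i `&` B)).
Proof.
have [mA fA] := tA i; have mAB : measurable (A i `&` B) by exact: measurableI.
apply/integrableP; split; first exact/measurable_EFinP.
rewrite (eq_integral (fun x => (\1_(A i `&` B) x)%:E)); last first.
  by move=> x _ /=; rewrite normr_nat.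
by rewrite integral_indic// setIT; exact: muAB.
Qed.

Let int_sum (r : seq I) :
  mu.-integrable setT (EFin \o (fun x => \sum_(i <- r) m i * \1_(A i `&` B) x)%R) /\
  \int[mu]_x (\sum_(i <- r) m i * \1_(A i `&` B) x)%R%:E =
  (\sum_(i <- r) m i * fine (mu (A i `&` B)))%R%:E.
Proof.
elim: r => [|i r [IH1 IH2]].
  rewrite big_nil; split.
    by apply: eq_integrable (integrable0 mu setT) => // x _ /=; rewrite big_nil.
  by rewrite integral0_eq// => x _; rewrite big_nil.
have i1 : mu.-integrable setT (EFin \o (fun x => m i * \1_(A i `&` B) x)%R).
  by apply: eq_integrable (integrableZl _ (m i) (int_indic i)) => // x _ /=.
split.
  apply: eq_integrable (integrableD _ i1 IH1) => // x _ /=.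
  by rewrite big_cons.
have [mA _] := tA i; have mAB : measurable (A i `&` B) by exact: measurableI.
rewrite big_cons EFinD -IH2.
have -> : (m i * fine (mu (A i `&` B)))%R%:E =
    \int[mu]_x (EFin \o (fun x => m i * \1_(A i `&` B) x)%R) x.
  rewrite /= (eq_integral (fun x => (m i)%:E * (\1_(A i `&` B) x)%:E))//.
  rewrite integralZl//; last exact: int_indic.
  by rewrite integral_indic// setIT EFinM fineK// ge0_fin_numE.
rewrite -integralD_EFin//; apply: eq_integral => x _ /=.
by rewrite big_cons EFinD.
Qed.

Lemma null_combination (r : seq I) :
  (\forall x \near (@affine_generic R d), \sum_(i <- r) m i * (x \in A i)%:R = 0)%R ->
  (\sum_(i <- r) m i * fine (mu (A i `&` B)) = 0)%R.
Proof.
move=> /affine_generic_null[N [mN N0 hN]]; have [i1 i2] := int_sum r.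
apply: EFin_inj; rewrite -i2.
rewrite (@negligible_integral _ _ _ mu setT N)// integral0_eq// => x [_ /hN h].
congr EFin; transitivity ((\sum_(i <- r) m i * (x \in A i)%:R) * (x \in B)%:R)%R.
  rewrite mulr_suml; apply: eq_bigr => i _.
  by rewrite indicE in_setI -mulrA -natrM mulnb.
by rewrite h mul0r.
Qed.

End null_combination.

(** Near a point off the facet hyperplanes all the indicators are constant, and
    a small box there has positive measure. *)
Lemma null_combination_generic d (I : finType) (m : I -> R)
    (v : I -> 'I_d.+1 -> 'rV[R]_d) :
  (forall i, vertex_mx (v i) \in unitmx) ->
  (forall B, measurable B ->
    \sum_i m i * fine (lebesgue_rV R d (hull (v i) `&` B)) = 0) ->
  \forall x \near affine_generic, \sum_i m i * (x \in hull (v i))%:R = 0.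
Proof.
move=> uv hB.
have nz : \forall x \near affine_generic, forall i j, coor (vertex_mx (v i)) (hat x) j != 0.
  by apply: filter_forall => i; exact: generic_hat (coor_neq0_generic (uv i)).
apply: filterS nz => x nz.
have : \forall y \near x, forall i j, coor (vertex_mx (v i)) (hat y) j != 0 /\
    (0 < coor (vertex_mx (v i)) (hat y) j) = (0 < coor (vertex_mx (v i)) (hat x) j).
  apply: near_forall => i; apply: near_forall => j.
  have := nz i j; case: ltrgt0P => // c0 _.
    by apply: near_imply (dot_hat_gt0_near c0) => y c; split=> //; exact: negbT (gt_eqF c).
  apply: near_imply (dot_hat_lt0_near c0) => y c; split; first exact: negbT (lt_eqF c).
  by apply/negbTE; rewrite -leNgt ltW.
move=> /nbhs_ballP[e /= e0 he].
pose B := box (fun i => x ord0 i - e) (fun i => x ord0 i + e).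
have Bv i : hull (v i) `&` B = if x \in hull (v i) then B else set0.
  have E y : B y -> (y \in hull (v i)) = (x \in hull (v i)).
    move=> By; have /he hy : ball x e y.
      split=> // i0 j0; rewrite (ord1 i0) /ball/= ltr_norml.
      by have := By j0; lra.
    rewrite !hull_inside//; last by move=> j; have [] := hy i j.
    by apply: eq_forallb => j; have [] := hy i j.
  apply/seteqP; split=> y.
    by move=> [vy By]; rewrite -(E y By) (mem_set vy).
  case: ifPn => // xv By; split => //; apply: set_mem; by rewrite E.
have muB : lebesgue_rV R d B = (\prod_(i < d) (e + e))%:E.
  rewrite box_measure => [|i]; last by lra.
  by congr EFin; apply: eq_bigr => i _; ring.
have pB : 0 < \prod_(i < d) (e + e) by apply: prodr_gt0 => i _; rewrite addr_gt0.
have := hB B (box_measurable _ _).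
rewrite (eq_bigr (fun i => m i * (x \in hull (v i))%:R * \prod_(i < d) (e + e))).
  rewrite -mulr_suml => /eqP; rewrite mulf_eq0 (gt_eqF pB) orbF => /eqP //.
move=> i _; rewrite Bv; case: ifP => _; first by rewrite muB mulr1.
by rewrite measure0 !mulr0 mul0r.
Qed.

End measure.

(** * The polarity automorphism *)

Section polar_involution.
Context {R : realType} {d : nat}.
Implicit Types v w : 'I_d.+1 -> 'rV[R]_d.

Lemma dot_ext (u u' : 'rV[R]_d) : (forall y, dot y u = dot y u') -> u = u'.
Proof.
by move=> h; apply/rowP => i; have := h (delta_mx 0 i); rewrite !(dotC (delta_mx _ _)) !dot_delta.
Qed.

(** Polarity is symmetric in the two simplices and determines each of them from
    the other. *)
Lemma polar_unique v w : vertex_mx v \in unitmx ->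
  (forall j, coor (vertex_mx v) (hat 0) j != 0) -> polar_vertices v w -> polar w = v.
Proof.
move=> uv l0 vw; apply/funext => j; apply: dot_ext => y.
have := coor_polar uv l0 vw y j; rewrite coor_hat (polar_coor0 uv l0 vw).
rewrite /polar dotZr (polar_coor0 uv l0 vw) => E; apply: (mulfI (l0 j)).
by rewrite mulrA mulrN mulfV// mulN1r; lra.
Qed.

Lemma sigma_polar v w : (0 < d)%N -> vertex_mx v \in unitmx ->
  (forall j, coor (vertex_mx v) (hat 0) j != 0) -> polar_vertices v w ->
  sigma w = sigma v.
Proof.
move=> d0 uv l0 vw; rewrite !sigmaE ?(polar_unit uv l0 vw)//.
by apply: eq_card => i; rewrite !inE (polar_coor0 uv l0 vw).
Qed.

End polar_involution.

Section additive_map.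
Variables (U V : zmodType) (f : U -> V).
Hypothesis fD : {morph f : x y / x + y}.

Lemma morphD0 : f 0 = 0.
Proof. by apply: (addrI (f 0)); rewrite -fD !addr0. Qed.

Lemma morphDN x : f (- x) = - f x.
Proof. by apply/eqP; rewrite -addr_eq0 -fD addNr morphD0. Qed.

Lemma morphDMz x (n : int) : f (x *~ n) = f x *~ n.
Proof.
have nat (k : nat) : f (x *+ k) = f x *+ k.
  by elim: k => [|k IH]; rewrite ?morphD0// !mulrS fD IH.
by case: n => k; [exact: nat|rewrite !NegzE !mulrNz morphDN; congr (- _); exact: nat].
Qed.

Lemma morphD_sum (I : Type) (r : seq I) (F : I -> U) :
  f (\sum_(i <- r) F i) = \sum_(i <- r) f (F i).
Proof. by elim: r => [|i r IH]; rewrite ?big_nil ?morphD0// !big_cons fD IH. Qed.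

End additive_map.

Section involution.
Context {R : realType} {d : nat}.
Hypothesis d0 : (0 < d)%N.

Definition nc_simplex := {v : 'I_d.+1 -> 'rV[R]_d | noncodegenerate_simplex v}.
Definition nc_simplex_measure (t : nc_simplex) : polytope_measure R d := simplex_measure (proj2_sig t).

Lemma nc_simplex_unit (t : nc_simplex) : vertex_mx (sval t) \in unitmx.
Proof. by have [] := (noncodegenerate_simplexP (sval t) d0).1 (proj2_sig t). Qed.

Lemma nc_simplex_coor0 (t : nc_simplex) j : coor (vertex_mx (sval t)) (hat 0) j != 0.
Proof. by have [] := (noncodegenerate_simplexP (sval t) d0).1 (proj2_sig t). Qed.

Lemma nc_simplex_polar_vertices (t : nc_simplex) : polar_vertices (sval t) (polar (sval t)).
Proof. exact: polar_polar_vertices (nc_simplex_unit t) (nc_simplex_coor0 t). Qed.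

Lemma polar_noncodegenerate (t : nc_simplex) : noncodegenerate_simplex (polar (sval t)).
Proof.
have ut := nc_simplex_unit t; have lt := @nc_simplex_coor0 t; have pt := nc_simplex_polar_vertices t.
have l0 j : coor (vertex_mx (polar (sval t))) (hat 0) j != 0.
  by rewrite (polar_coor0 ut lt pt).
exact (proj2 (noncodegenerate_simplexP _ d0) (conj (polar_unit ut lt pt) l0)).
Qed.

Definition polar_simp (t : nc_simplex) : nc_simplex := exist _ _ (polar_noncodegenerate t).

Definition polar_sign (t : nc_simplex) : int := (-1) ^+ sigma (sval t).

Lemma polar_sign_polar t : polar_sign (polar_simp t) = polar_sign t.
Proof.
rewrite /polar_sign (sigma_polar d0 (nc_simplex_unit t) (@nc_simplex_coor0 t))//.
exact: nc_simplex_polar_vertices.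
Qed.

Lemma nc_simplex_measure_polarK t : nc_simplex_measure (polar_simp (polar_simp t)) = nc_simplex_measure t.
Proof.
apply: val_inj => /=; congr (lebesgue_on (hull _)).
exact: polar_unique (nc_simplex_unit t) (@nc_simplex_coor0 t) (nc_simplex_polar_vertices t).
Qed.

Definition comb (s : seq (int * nc_simplex)) : polytope_measure R d :=
  \sum_(k <- s) nc_simplex_measure k.2 *~ k.1.

Definition polar_comb (s : seq (int * nc_simplex)) : seq (int * nc_simplex) :=
  [seq (k.1 * polar_sign k.2, polar_simp k.2) | k <- s].

Lemma comb_cat s t : comb (s ++ t) = comb s + comb t.
Proof. exact: big_cat. Qed.

Definition scale_comb (n : int) (s : seq (int * nc_simplex)) := [seq (n * k.1, k.2) | k <- s].

Lemma comb_scale n s : comb (scale_comb n s) = comb s *~ n.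
Proof.
rewrite /comb big_map mulrz_suml; apply: eq_bigr => k _.
by rewrite mulrC mulrzA.
Qed.

Lemma polar_comb_scale n s : polar_comb (scale_comb n s) = scale_comb n (polar_comb s).
Proof. by rewrite /polar_comb /scale_comb -!map_comp; apply: eq_map => k /=; rewrite mulrA. Qed.

Lemma comb_polarK s : comb (polar_comb (polar_comb s)) = comb s.
Proof.
rewrite /comb !big_map; apply: eq_bigr => k _ /=.
by rewrite nc_simplex_measure_polarK polar_sign_polar -mulrA -expr2 sqrr_sign mulr1.
Qed.

Lemma comb_val s (B : borel_set R d) : \val (comb s) B =
  \sum_(k <- s) k.1%:~R * fine (lebesgue_rV R d (hull (sval k.2) `&` \val B)).
Proof.
rewrite (@morphD_sum _ _ (fun mu : polytope_measure R d => \val mu B)) => [|x y].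
  apply: eq_bigr => k _.
  rewrite (@morphDMz _ _ (fun mu : polytope_measure R d => \val mu B)) => [|x y].
    by rewrite -mulrzl.
  by rewrite raddfD.
by rewrite raddfD.
Qed.

(** The dictionary between measures and functions off hyperplanes. *)
Lemma comb_eq0 s : comb s = 0 <-> \forall x \near affine_generic,
  \sum_(k <- s) k.1%:~R * (x \in hull (sval k.2))%:R = 0 :> R.
Proof.
split=> [s0|hs]; last first.
  apply: val_inj; apply/funext => B; rewrite comb_val.
  have := @null_combination R d _ (fun k : int * nc_simplex => k.1%:~R)
    (fun k => hull (sval k.2)) (fun k => finite_measure_hull _) (\val B) (set_mem (valP B)) s hs.
  by move=> ->; rewrite raddf0.
have : \forall x \near affine_generic, \sum_(i < size s)
    (tnth (in_tuple s) i).1%:~R * (x \in hull (sval (tnth (in_tuple s) i).2))%:R = 0 :> R.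
  apply: null_combination_generic => [i|B mB]; first exact: nc_simplex_unit.
  have := congr1 (fun mu : polytope_measure R d => \val mu (exist _ B (mem_set mB))) s0.
  by rewrite comb_val raddf0 big_tnth.
by apply: filterS => x; rewrite (big_tnth _ _ s).
Qed.

Lemma polar_comb_eq0 s : comb s = 0 -> comb (polar_comb s) = 0.
Proof.
move=> /comb_eq0 hs; apply/comb_eq0.
have : \forall y \near affine_generic, \sum_(i < size s)
    (tnth (in_tuple s) i).1%:~R * ((-1) ^+ sigma (sval (tnth (in_tuple s) i).2) *
    (y \in hull (polar (sval (tnth (in_tuple s) i).2)))%:R) = 0 :> R.
  apply: (@polar_relation _ _ d0 _ _ (fun i => sval (tnth (in_tuple s) i).2)) => [i|i j|i|].
  - exact: nc_simplex_unit.
  - exact: nc_simplex_coor0.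
  - exact: nc_simplex_polar_vertices.
  - by apply: filterS hs => x; rewrite (big_tnth _ _ s).
apply: filterS => y hy; rewrite -[RHS]hy big_map (big_tnth _ _ s); apply: eq_bigr => i _ /=.
by rewrite intrM rmorphXn rmorphN1 mulrA.
Qed.

Lemma polytope_comb (P : set 'rV[R]_d) : polytope P -> ~ codegenerate P ->
  exists s, lebesgue_on P = \val (comb s).
Proof.
move=> pP ncP; have [s0 ncs0 hs0] := noncodegenerate_span ncP (polytope_simplex_span pP).
have [s Es] : exists s : seq (int * nc_simplex), [seq (k.1, sval k.2) | k <- s] = s0.
  elim: s0 ncs0 {hs0} => [|[n v] s0 IH] /=; first by exists [::].
  move=> /andP[/andP[uv /forallP l0] /IH[s <-]].
  have nv : noncodegenerate_simplex v.
    exact (proj2 (noncodegenerate_simplexP _ d0) (conj uv l0)).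
  by exists ((n, exist _ v nv) :: s).
exists s; apply/funext => B; rewrite comb_val.
(* The index None stands for the polytope P itself. *)
pose A (k : option (int * nc_simplex)) := if k is Some k then hull (sval k.2) else P.
pose m (k : option (int * nc_simplex)) : R := if k is Some k then - k.1%:~R else 1.
have tA k : finite_measure_set (A k).
  by case: k => [k|]; [exact: finite_measure_hull|exact: finite_measure_polytope].
have := @null_combination R d _ m A tA (\val B) (set_mem (valP B))
  (None :: [seq Some k | k <- s]).
rewrite big_cons big_map mul1r => h; apply/eqP; rewrite -subr_eq0; apply/eqP.
rewrite -[RHS]h.
  by rewrite -sumrN; congr (_ + _); apply: eq_bigr => k _; rewrite mulNr.
have : \forall x \near affine_generic, forall i : 'I_(size s),
    let k := tnth (in_tuple s) i in
    (x \in hull (sval k.2)) = inside (vertex_mx (sval k.2)) (hat x).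
  by apply: filter_forall => i; exact: hull_inside_generic (nc_simplex_unit _).
apply: filterS2 hs0 => x + hx; rewrite -Es big_map big_cons big_map mul1r => -> /=.
rewrite !(big_tnth _ _ s) -big_split/= big1// => i _.
by have /= -> := hx i; rewrite mulNr subrr.
Qed.

Lemma generated mu : exists s, mu = comb s.
Proof.
have /asboolP[n [P [alpha [hP Emu]]]] := valP mu.
have /choice[s hs] i : exists s, lebesgue_on (P i) = \val (comb s).
  by have [pP ncP] := hP i; exact: polytope_comb.
exists (flatten [seq scale_comb (alpha i) (s i) | i <- enum 'I_n]).
have -> : comb (flatten [seq scale_comb (alpha i) (s i) | i <- enum 'I_n]) =
    \sum_(i < n) comb (s i) *~ alpha i.
  rewrite -big_enum/=; elim: (enum _) => [|i r IH] /=.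
    by rewrite /comb !big_nil.
  by rewrite comb_cat IH comb_scale big_cons.
apply: val_inj; rewrite Emu raddf_sum; apply: eq_bigr => i _.
by rewrite raddfMz hs.
Qed.

(** A chosen decomposition; the values of polar_map do not depend on it, by
    polar_comb_eq0. *)
Definition decomp mu : seq (int * nc_simplex) := projT1 (cid (generated mu)).

Lemma decompK mu : comb (decomp mu) = mu.
Proof. by rewrite /decomp; case: cid. Qed.

Definition polar_map mu := comb (polar_comb (decomp mu)).

(** Two decompositions of the same measure differ by a relation, which polarity
    preserves. *)
Lemma polar_map_comb s : polar_map (comb s) = comb (polar_comb s).
Proof.
apply/eqP; rewrite -subr_eq0 /polar_map -mulrN1z -comb_scale -polar_comb_scale.
rewrite -comb_cat /polar_comb -map_cat -/(polar_comb _); apply/eqP.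
apply: polar_comb_eq0; rewrite comb_cat comb_scale decompK mulrN1z subrr//.
Qed.

Lemma polar_mapD : {morph polar_map : x y / x + y}.
Proof.
move=> x y; rewrite -{1}(decompK x) -{1}(decompK y) -comb_cat polar_map_comb.
by rewrite /polar_comb map_cat comb_cat.
Qed.

Lemma polar_mapK : involutive polar_map.
Proof. by move=> mu; rewrite {2}/polar_map polar_map_comb comb_polarK decompK. Qed.

Lemma polar_map_simplex t n : polar_map (nc_simplex_measure t *~ n) = nc_simplex_measure (polar_simp t) *~ (n * polar_sign t).
Proof.
have -> : nc_simplex_measure t *~ n = comb [:: (n, t)] by rewrite /comb big_seq1.
by rewrite polar_map_comb /comb big_seq1.
Qed.

Lemma polar_map_signed x : signed_simplex_measures R d x ->
  signed_simplex_measures R d (polar_map x).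
Proof.
move=> [b [v [hv ->]]]; pose t : nc_simplex := exist _ v hv.
exists (b (+) odd (sigma v)), (polar v), (polar_noncodegenerate t).
by rewrite (polar_map_simplex t) signr_addb signr_odd.
Qed.

End involution.

Theorem theorem1 (R : realType) (d : nat) (hd : (1 <= d)%N) :
  exists phi : signed_simplex_measures R d -> signed_simplex_measures R d,
    [/\ forall (b : bool) (v : 'I_d.+1 -> 'rV[R]_d)
          (hv : noncodegenerate_simplex v) (x : signed_simplex_measures R d),
          \val x = simplex_measure hv *~ (-1) ^+ b ->
          exists (w : 'I_d.+1 -> 'rV[R]_d) (hw : noncodegenerate_simplex w),
            polar_vertices v w /\
            \val (phi x) = simplex_measure hw *~ ((-1) ^+ b * (-1) ^+ sigma v),
        involutive phi
      & exists! Phi : polytope_measure R d -> polytope_measure R d,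
          [/\ {morph Phi : x y / x + y}, bijective Phi
            & forall x : signed_simplex_measures R d,
                Phi (\val x) = \val (phi x)]].
Proof.
exists (fun x => exist _ (polar_map hd (\val x))
  (mem_set (polar_map_signed hd (set_mem (valP x))))); split.
- move=> b v hv x xE; pose t : nc_simplex := exist _ v hv.
  exists (polar v), (polar_noncodegenerate hd t); split.
    exact: (nc_simplex_polar_vertices hd t).
  by rewrite /= [sval x]xE (polar_map_simplex hd t).
- by move=> x; apply: val_inj; rewrite /= polar_mapK.
exists (polar_map hd); split.
  split=> //; first exact: polar_mapD.
  by exists (polar_map hd); exact: polar_mapK.
move=> Phi [PhiD _ Phi_phi]; apply/funext => mu.
rewrite -(decompK hd mu) /comb (morphD_sum (polar_mapD hd)) (morphD_sum PhiD).
apply: eq_bigr => k _; rewrite (morphDMz (polar_mapD hd)) (morphDMz PhiD).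
have sk : signed_simplex_measures R d (nc_simplex_measure k.2).
  by exists false, (sval k.2), (proj2_sig k.2).
by have := Phi_phi (exist (fun x => x \in signed_simplex_measures R d) _ (mem_set sk)) => /= ->.
Qed.
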